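(* Let $\mathbb{F}$ be a field, let $G\to \mathrm{GL}(4,\mathbb{F})$ be a representation of a finite group $G$, and let $R:=\mathbb{F}[x_1,\dots,x_4]^G$ be the invariant ring. Let $\mathfrak{a}$ be a homogeneous ideal of $R$ such that the local cohomology module $H^i_{\mathfrak{a}}(R)$ has finite length as an $R$-module for some $i$. Then $H^i_{\mathfrak{a}}(R)=0$ (for that $i$).
   Context: $G$ acts on the polynomial ring $\mathbb{F}[x_1,\dots,x_4]$ by degree-preserving $\mathbb{F}$-algebra automorphisms induced by the representation; $R$ is the graded subring of $G$-invariants. $H^i_{\mathfrak{a}}(-)$ denotes the $i$-th local cohomology (cohomology of the Čech complex on a generating set of $\mathfrak{a}$). *)

(* Defs.v *)
From HB Require Import structures.
From mathcomp Require Import all_boot all_order all_algebra all_fingroup.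
From mathcomp Require Import mxrepresentation generic_quotient ring.
From mathcomp Require Import boolp.
From mathcomp Require Import mpoly.

Set Implicit Arguments.
Unset Strict Implicit.
Unset Printing Implicit Defensive.

Import GRing.Theory.

Local Open Scope ring_scope.
Local Open Scope quotient_scope.

(* Submodules, ideals and relations are boolean predicates; [boolp] makes
   every proposition decidable, so this is no restriction. *)

Section FiniteLength.
Variables (R : pzRingType) (M : lmodType R).

Definition maximal_submod (N N' : {pred M}) : Prop :=
  [/\ {subset N <= N'}, (exists2 x, x \in N' & x \notin N)
    & forall L : {pred M}, submod_closed L ->
        {subset N <= L} -> {subset L <= N'} -> L =i N \/ L =i N'].

(* Existence of a composition series 0 = N_0 < N_1 < ... < N_l = M: the factor
   N_(k+1) / N_k is simple iff N_k is a maximal proper submodule of N_(k+1). *)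
Definition finite_length : Prop :=
  exists (l : nat) (N : nat -> {pred M}),
    [/\ forall k, submod_closed (N k), N 0%N =i pred1 0, N l =i predT
      & forall k, (k < l)%N -> maximal_submod (N k) (N k.+1)].

End FiniteLength.

(* The quotient of an R-module by a submodule: [Quotient.quot] of
   [ring_quotient] is only a zmodType, so we add the scalar action. *)
Section QuotientModule.
Variables (R : pzRingType) (M : lmodType R) (N : submodClosed M).

Definition submod_pred : {pred M} := [pred x | x \in N].

Fact submod_pred_zmod : zmod_closed submod_pred.
Proof. exact: GRing.submod_closedB (submodClosedP N). Qed.
HB.instance Definition _ :=
  GRing.isZmodClosed.Build M submod_pred submod_pred_zmod.

Definition quotmod := Quotient.quot submod_pred.
HB.instance Definition _ := GRing.Zmodule.on quotmod.
HB.instance Definition _ :=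
  generic_quotient.Quotient.copy quotmod (Quotient.quot submod_pred).

Definition quotmod_scale (a : R) (u : quotmod) : quotmod :=
  \pi_quotmod (a *: repr u).

Lemma pi_quotmodP (x y : M) :
  (\pi_quotmod x == \pi_quotmod y) = (x - y \in N).
Proof. by rewrite -[RHS]/(x - y \in submod_pred) Quotient.idealrBE. Qed.

Lemma pi_quotmodD (x y : M) :
  \pi_quotmod (x + y) = \pi_quotmod x + \pi_quotmod y.
Proof. exact: (Quotient.pi_add submod_pred). Qed.

Lemma quotmod_scaleE a x : quotmod_scale a (\pi_quotmod x) = \pi_quotmod (a *: x).
Proof.
apply/eqP; rewrite /quotmod_scale pi_quotmodP -scalerBr; apply: rpredZ.
by rewrite -pi_quotmodP reprK.
Qed.

Fact quotmod_scaleA a b u :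
  quotmod_scale a (quotmod_scale b u) = quotmod_scale (a * b) u.
Proof.
by rewrite -[u]reprK [quotmod_scale b _]quotmod_scaleE !quotmod_scaleE scalerA.
Qed.
Fact quotmod_scale1 : left_id 1 quotmod_scale.
Proof. by move=> u; rewrite -[u]reprK quotmod_scaleE scale1r. Qed.
Fact quotmod_scaleDr : right_distributive quotmod_scale +%R.
Proof.
move=> a u v; rewrite -[u]reprK -[v]reprK -pi_quotmodD !quotmod_scaleE.
by rewrite scalerDr pi_quotmodD.
Qed.
Fact quotmod_scaleDl u : {morph quotmod_scale^~ u : a b / a + b}.
Proof.
by move=> a b; rewrite -[u]reprK !quotmod_scaleE scalerDl pi_quotmodD.
Qed.
HB.instance Definition _ := GRing.Zmodule_isLmodule.Build R quotmod
  quotmod_scaleA quotmod_scale1 quotmod_scaleDr quotmod_scaleDl.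

End QuotientModule.

(* The localization M_x = M[1/x]: pairs (u, k), standing for u / x^k, up to
   (u, k) ~ (v, l) iff x^n (x^l u - x^k v) = 0 for some n. *)
Section Localization.
Variables (R : comNzRingType) (M : lmodType R) (x : R).

Definition loc_equiv (p q : M * nat) : bool :=
  `[< exists n, x ^+ n *: (x ^+ q.2 *: p.1 - x ^+ p.2 *: q.1) = 0 >].

Fact loc_equiv_is_equiv : equiv_class_of loc_equiv.
Proof.
split=> [p|p q|q p r].
- by apply/asboolP; exists 0%N; rewrite subrr scaler0.
- by apply/asboolP/asboolP=> -[n h]; exists n;
    rewrite -opprB scalerN h oppr0.
move=> /asboolP[n h] /asboolP[m k]; apply/asboolP.
exists (n + m + q.2)%N.
have -> : x ^+ (n + m + q.2) *: (x ^+ r.2 *: p.1 - x ^+ p.2 *: r.1) =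
    x ^+ (m + r.2) *: (x ^+ n *: (x ^+ q.2 *: p.1 - x ^+ p.2 *: q.1))
  + x ^+ (n + p.2) *: (x ^+ m *: (x ^+ r.2 *: q.1 - x ^+ q.2 *: r.1)).
  rewrite !scalerBr !scalerA -!exprD.
  have -> : (m + r.2 + n + p.2 = n + p.2 + m + r.2)%N by ring.
  rewrite addrA addrNK; congr (_ ^+ _ *: _ - _ ^+ _ *: _); ring.
by rewrite h k !scaler0 addr0.
Qed.
Canonical loc_equiv_equiv := EquivRelPack loc_equiv_is_equiv.
Canonical loc_equiv_encModRel := defaultEncModRel loc_equiv.

Definition loc := {eq_quot loc_equiv}.
HB.instance Definition _ : EqQuotient _ loc_equiv loc := EqQuotient.on loc.
HB.instance Definition _ := Choice.on loc.

Definition loc_frac (u : M) (k : nat) : loc := \pi_loc (u, k).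

Lemma loc_fracP u k v l :
  loc_frac u k = loc_frac v l <->
  exists n, x ^+ n *: (x ^+ l *: u - x ^+ k *: v) = 0.
Proof.
split=> [/eqP|h]; first by rewrite /loc_frac piE => /asboolP.
by apply/eqP; rewrite /loc_frac piE; apply/asboolP.
Qed.

Lemma loc_fracK (p : loc) : loc_frac (repr p).1 (repr p).2 = p.
Proof. by rewrite /loc_frac -surjective_pairing reprK. Qed.

Lemma loc_frac_ind (P : loc -> Prop) :
  (forall u k, P (loc_frac u k)) -> forall p, P p.
Proof. by move=> h p; rewrite -[p]loc_fracK. Qed.

Definition loc_add (p q : loc) : loc :=
  loc_frac (x ^+ (repr q).2 *: (repr p).1 + x ^+ (repr p).2 *: (repr q).1)
           ((repr p).2 + (repr q).2).
Definition loc_opp (p : loc) : loc := loc_frac (- (repr p).1) (repr p).2.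
Definition loc_scale (a : R) (p : loc) : loc :=
  loc_frac (a *: (repr p).1) (repr p).2.

Lemma repr_loc u k : exists n,
  x ^+ n *: (x ^+ k *: (repr (loc_frac u k)).1
             - x ^+ (repr (loc_frac u k)).2 *: u) = 0.
Proof. by apply/loc_fracP; rewrite loc_fracK. Qed.

Lemma loc_addE u k v l :
  loc_add (loc_frac u k) (loc_frac v l) =
  loc_frac (x ^+ l *: u + x ^+ k *: v) (k + l).
Proof.
rewrite /loc_add.
have := repr_loc u k; have := repr_loc v l.
move: (repr (loc_frac u k)) (repr (loc_frac v l)) => -[u' k'] [v' l'] /=.
move=> [m hm] [n hn]; apply/loc_fracP; exists (m + n)%N.
transitivity (x ^+ (m + l + l') *: (x ^+ n *: (x ^+ k *: u' - x ^+ k' *: u))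
  + x ^+ (n + k + k') *: (x ^+ m *: (x ^+ l *: v' - x ^+ l' *: v))); last first.
  by rewrite hm hn !scaler0 addr0.
rewrite !(scalerBr, scalerDr) !scalerA -!exprD opprD.
rewrite addrACA; congr (_ ^+ _ *: _ - _ ^+ _ *: _ + (_ ^+ _ *: _ - _ ^+ _ *: _)); ring.
Qed.

Lemma loc_oppE u k : loc_opp (loc_frac u k) = loc_frac (- u) k.
Proof.
rewrite /loc_opp; have := repr_loc u k.
move: (repr (loc_frac u k)) => -[u' k'] /= [n hn]; apply/loc_fracP; exists n.
by rewrite !scalerN -opprD scalerN hn oppr0.
Qed.

Lemma loc_scaleE a u k : loc_scale a (loc_frac u k) = loc_frac (a *: u) k.
Proof.
rewrite /loc_scale; have := repr_loc u k.
move: (repr (loc_frac u k)) => -[u' k'] /= [n hn]; apply/loc_fracP; exists n.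
by rewrite 2![x ^+ _ *: (a *: _)]scalerA ![_ * a]mulrC -!scalerA -scalerBr
  scalerA mulrC -scalerA hn scaler0.
Qed.

Lemma loc_frac_eq u k v l : x ^+ l *: u = x ^+ k *: v ->
  loc_frac u k = loc_frac v l.
Proof. by move=> h; apply/loc_fracP; exists 0%N; rewrite h subrr scaler0. Qed.

Fact loc_addA : associative loc_add.
Proof.
elim/loc_frac_ind=> u k; elim/loc_frac_ind=> v l; elim/loc_frac_ind=> w m.
rewrite !loc_addE addnA; congr loc_frac.
rewrite !scalerDr !scalerA -!exprD addrA.
by congr (_ ^+ _ *: _ + _ ^+ _ *: _ + _); ring.
Qed.
Fact loc_addC : commutative loc_add.
Proof.
elim/loc_frac_ind=> u k; elim/loc_frac_ind=> v l.
by rewrite !loc_addE addnC addrC.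
Qed.
Fact loc_add0 : left_id (loc_frac 0 0) loc_add.
Proof.
by elim/loc_frac_ind=> u k; rewrite loc_addE scaler0 add0r scale1r.
Qed.
Fact loc_addN : left_inverse (loc_frac 0 0) loc_opp loc_add.
Proof.
elim/loc_frac_ind=> u k; rewrite loc_oppE loc_addE scalerN addNr.
by apply: loc_frac_eq; rewrite !scaler0.
Qed.
HB.instance Definition _ := GRing.isZmodule.Build loc
  loc_addA loc_addC loc_add0 loc_addN.

Lemma loc_frac0 k : loc_frac 0 k = 0.
Proof. by apply: loc_frac_eq; rewrite !scaler0. Qed.

Lemma loc_fracD u v k : loc_frac (u + v) k = loc_frac u k + loc_frac v k.
Proof.
rewrite [RHS]loc_addE; apply: loc_frac_eq.
by rewrite -scalerDr !scalerA -!exprD.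
Qed.

Fact loc_scaleA a b p : loc_scale a (loc_scale b p) = loc_scale (a * b) p.
Proof. by elim/loc_frac_ind: p => u k; rewrite !loc_scaleE scalerA. Qed.
Fact loc_scale1 : left_id 1 loc_scale.
Proof. by elim/loc_frac_ind=> u k; rewrite loc_scaleE scale1r. Qed.
Fact loc_scaleDr : right_distributive loc_scale +%R.
Proof.
move=> a; elim/loc_frac_ind=> u k; elim/loc_frac_ind=> v l.
rewrite [loc_frac u k + _]loc_addE !loc_scaleE [RHS]loc_addE scalerDr.
by rewrite !scalerA ![_ * a]mulrC.
Qed.
Fact loc_scaleDl p : {morph loc_scale^~ p : a b / a + b}.
Proof.
by move=> a b; elim/loc_frac_ind: p => u k;
  rewrite !loc_scaleE scalerDl loc_fracD.
Qed.
HB.instance Definition _ := GRing.Zmodule_isLmodule.Build R loc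
  loc_scaleA loc_scale1 loc_scaleDr loc_scaleDl.

Lemma loc_fracZ a u k : loc_frac (a *: u) k = a *: loc_frac u k.
Proof. by rewrite -[RHS]/(loc_scale _ _) loc_scaleE. Qed.

End Localization.

(* The canonical map M_x -> M_y, u / x^k |-> (z^k u) / y^k. It is meaningful
   only when y = x * z; taking x, y and z as separate arguments spares a cast
   in the Cech differential. *)
Definition loc_map (R : comNzRingType) (M : lmodType R) (x y z : R)
    (p : loc M x) : loc M y :=
  loc_frac y (z ^+ (repr p).2 *: (repr p).1) (repr p).2.

Section LocMap.
Variables (R : comNzRingType) (M : lmodType R) (x y z : R).
Hypothesis yE : y = x * z.

Lemma loc_mapE (u : M) k :
  loc_map y z (loc_frac x u k) = loc_frac y (z ^+ k *: u) k.
Proof.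
rewrite /loc_map; have := repr_loc x u k.
move: (repr (loc_frac x u k)) => -[u' k'] /= [n hn].
apply/loc_fracP; exists n; rewrite yE !exprMn.
transitivity ((z ^+ (n + k + k')) *:
   (x ^+ n *: (x ^+ k *: u' - x ^+ k' *: u))); last by rewrite hn scaler0.
by rewrite !scalerBr !scalerA; congr (_ *: _ - _ *: _); rewrite !exprD; ring.
Qed.

Lemma loc_map_is_linear : linear (@loc_map R M x y z).
Proof.
move=> a; elim/loc_frac_ind=> u k; elim/loc_frac_ind=> v l.
rewrite -loc_fracZ [_ + _]loc_addE !loc_mapE -loc_fracZ [RHS]loc_addE.
congr loc_frac; rewrite scalerDr !scalerA yE !exprMn !exprD.
by congr (_ *: _ + _ *: _); ring.
Qed.

End LocMap.

Lemma loc_map_comp (R : comNzRingType) (M : lmodType R) (x y w z z' : R)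
    (p : loc M x) : y = x * z -> w = y * z' ->
  loc_map w z' (loc_map y z p) = loc_map w (z * z') p.
Proof.
move=> yE wE; elim/loc_frac_ind: p => u k.
by rewrite !loc_mapE ?mulrA -?yE // exprMn scalerA mulrC.
Qed.

Section DependentProduct.
Variables (R : pzRingType) (I : finType) (T : I -> lmodType R).

Definition dprodmod := {dffun forall i, T i}.
HB.instance Definition _ := Choice.on dprodmod.
Implicit Types c b : dprodmod.

Definition dprod_zero : dprodmod := [ffun i => 0].
Definition dprod_opp c : dprodmod := [ffun i => - c i].
Definition dprod_add c b : dprodmod := [ffun i => c i + b i].
Definition dprod_scale (a : R) c : dprodmod := [ffun i => a *: c i].

Fact dprod_addA : associative dprod_add.
Proof. by move=> c b d; apply/ffunP=> i; rewrite !ffunE addrA. Qed.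
Fact dprod_addC : commutative dprod_add.
Proof. by move=> c b; apply/ffunP=> i; rewrite !ffunE addrC. Qed.
Fact dprod_add0 : left_id dprod_zero dprod_add.
Proof. by move=> c; apply/ffunP=> i; rewrite !ffunE add0r. Qed.
Fact dprod_addN : left_inverse dprod_zero dprod_opp dprod_add.
Proof. by move=> c; apply/ffunP=> i; rewrite !ffunE addNr. Qed.
HB.instance Definition _ := GRing.isZmodule.Build dprodmod
  dprod_addA dprod_addC dprod_add0 dprod_addN.

Fact dprod_scaleA a a' c :
  dprod_scale a (dprod_scale a' c) = dprod_scale (a * a') c.
Proof. by apply/ffunP=> i; rewrite !ffunE scalerA. Qed.
Fact dprod_scale1 : left_id 1 dprod_scale.
Proof. by move=> c; apply/ffunP=> i; rewrite !ffunE scale1r. Qed.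
Fact dprod_scaleDr : right_distributive dprod_scale +%R.
Proof. by move=> a c b; apply/ffunP=> i; rewrite !ffunE scalerDr. Qed.
Fact dprod_scaleDl c : {morph dprod_scale^~ c : a a' / a + a'}.
Proof. by move=> a a'; apply/ffunP=> i; rewrite !ffunE scalerDl. Qed.
HB.instance Definition _ := GRing.Zmodule_isLmodule.Build R dprodmod
  dprod_scaleA dprod_scale1 dprod_scaleDr dprod_scaleDl.

Lemma dprod0E i : (0 : dprodmod) i = 0.
Proof. by rewrite ffunE. Qed.
Lemma dprodDE c b i : (c + b) i = c i + b i.
Proof. by rewrite ffunE. Qed.
Lemma dprodZE a c i : (a *: c) i = a *: c i.
Proof. by rewrite ffunE. Qed.

End DependentProduct.

(* The Cech complex of M on f_0, ..., f_(n-1). The total cochain module is the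
   product over all S of the localizations M_(f_S), where f_S is the product of
   the f_j for j in S; its degree k part consists of the families supported on
   the S of cardinal k. *)
Section CechComplex.
Variables (R : comNzRingType) (n : nat) (f : 'I_n -> R) (M : lmodType R).
Implicit Types S : {set 'I_n}.

Definition cech_prod S : R := \prod_(j in S) f j.

Definition cochain := dprodmod (fun S => loc M (cech_prod S) : lmodType R).
HB.instance Definition _ := GRing.Lmodule.on cochain.
Implicit Types c b : cochain.

Definition cech_sign S (j : 'I_n) : nat := #|[set l in S | (l < j)%N]|.

Definition cech_d c : cochain :=
  [ffun S : {set 'I_n} =>
     \sum_(j in S) (-1) ^+ cech_sign S j *:
       loc_map (cech_prod S) (f j) (c (S :\ j))].

Definition in_degree (k : nat) : {pred cochain} :=
  [pred c : cochain | [forall S : {set 'I_n}, (#|S| == k) || (c S == 0)]].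

Lemma in_degreeP k c :
  reflect (forall S, #|S| != k -> c S = 0) (c \in in_degree k).
Proof.
apply: (iffP forallP) => h S; last first.
  by case: eqVneq => //= /h ->.
by move/negPf=> Sk; move: (h S); rewrite Sk => /eqP.
Qed.

Lemma cech_prodD1 S j : j \in S -> cech_prod S = cech_prod (S :\ j) * f j.
Proof. by move=> jS; rewrite /cech_prod (big_setD1 j) // mulrC. Qed.

Lemma cech_d_is_linear : linear cech_d.
Proof.
move=> a c b; apply/ffunP=> S; rewrite dprodDE dprodZE !ffunE.
rewrite scaler_sumr -big_split; apply: eq_bigr => j jS /=.
rewrite !ffunE (loc_map_is_linear (cech_prodD1 jS)) scalerDr !scalerA.
by rewrite [a * _]mulrC.
Qed.
HB.instance Definition _ :=
  GRing.isLinear.Build R cochain cochain _ cech_d cech_d_is_linear.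

Fact in_degree_closed k : submod_closed (in_degree k).
Proof.
split=> [|a c b /in_degreeP hc /in_degreeP hb]; apply/in_degreeP=> S Sk.
  by rewrite dprod0E.
by rewrite dprodDE dprodZE hc // hb // scaler0 addr0.
Qed.
HB.instance Definition _ k :=
  GRing.isSubmodClosed.Build R cochain (in_degree k) (in_degree_closed k).

Lemma cech_d_degree k c : c \in in_degree k -> cech_d c \in in_degree k.+1.
Proof.
move=> /in_degreeP hc; apply/in_degreeP=> S Sk; rewrite ffunE big1 // => j jS.
rewrite hc; last by move: Sk; rewrite (cardsD1 j) jS add1n eqSS.
rewrite -(loc_frac0 M (cech_prod (S :\ j)) 0) (loc_mapE (cech_prodD1 jS)).
by rewrite scaler0 loc_frac0 scaler0.
Qed.

Lemma cech_sign_swap S (j l : 'I_n) : j \in S -> l \in S -> (l < j)%N ->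
  (-1) ^+ cech_sign S j * (-1) ^+ cech_sign (S :\ j) l =
  - ((-1) ^+ cech_sign S l * (-1) ^+ cech_sign (S :\ l) j) :> R.
Proof.
move=> jS lS lj.
have -> : cech_sign (S :\ j) l = cech_sign S l.
  apply: eq_card => m; rewrite !inE; case: eqVneq => // ->.
  by rewrite ltnNge (ltnW lj) !andbF.
have -> : cech_sign S j = (cech_sign (S :\ l) j).+1.
  rewrite /cech_sign (cardsD1 l) !inE lS lj add1n; congr _.+1.
  by apply: eq_card => m; rewrite !inE andbA.
by rewrite exprS mulN1r mulNr mulrC.
Qed.

Lemma cech_dK c : cech_d (cech_d c) = 0.
Proof.
apply/ffunP=> S; rewrite dprod0E ffunE.
pose t (j l : 'I_n) : loc M (cech_prod S) :=
  loc_map (cech_prod S) (f l * f j) (c (S :\ j :\ l)).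
pose e (j l : 'I_n) : R := (-1) ^+ cech_sign S j * (-1) ^+ cech_sign (S :\ j) l.
have tC j l : t j l = t l j by rewrite /t mulrC !setDDl setUC.
transitivity (\sum_(j in S) \sum_(l in S | l != j) e j l *: t j l).
  apply: eq_bigr => j jS; rewrite ffunE.
  pose h : {linear loc M (cech_prod (S :\ j)) -> loc M (cech_prod S)} :=
    HB.pack (@loc_map R M (cech_prod (S :\ j)) (cech_prod S) (f j))
      (GRing.isLinear.Build _ _ _ _ _
         (loc_map_is_linear (cech_prodD1 jS))).
  rewrite -[loc_map _ _ _]/(h _) linear_sum scaler_sumr /=.
  apply: eq_big => [l|l lS]; first by rewrite !inE andbC.
  rewrite -[loc_map _ _ _]/(h _) linearZ /= scalerA; congr (_ *: _).
  exact: loc_map_comp (cech_prodD1 lS) (cech_prodD1 jS).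
transitivity (\sum_(j in S) (\sum_(l in S | (l < j)%N) e j l *: t j l
    + \sum_(l in S | (j < l)%N) e j l *: t j l)).
  apply: eq_bigr => j jS; rewrite (bigID (fun l : 'I_n => (l < j)%N)) /=.
  by congr (_ + _); apply: eq_bigl => l; rewrite -andbA; case: (l \in S) => //=;
    rewrite -val_eqE /=; case: ltngtP.
rewrite big_split /= [X in _ + X](exchange_big_dep (mem S)) /=; last first.
  by move=> j l _ /andP[].
rewrite -big_split big1 //= => j jS.
rewrite [X in _ + X](eq_bigl (fun l => (l \in S) && (l < j)%N)); last first.
  by move=> l; rewrite jS.
rewrite -big_split big1 //= => l /andP[lS lj].
by rewrite (tC l j) -scalerDl /e cech_sign_swap // addNr scale0r.
Qed.

Definition cocycle k : {pred cochain} :=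
  [pred c | (c \in in_degree k) && (cech_d c == 0)].

Lemma cocycleE k c :
  (c \in cocycle k) = (c \in in_degree k) && (cech_d c == 0).
Proof. by []. Qed.

Fact cocycle_closed k : submod_closed (cocycle k).
Proof.
split=> [|a c b]; rewrite !cocycleE; first by rewrite rpred0 linear0 eqxx.
move=> /andP[ck /eqP c0] /andP[bk /eqP b0].
by rewrite linearP /= c0 b0 scaler0 addr0 eqxx andbT rpredD ?rpredZ.
Qed.
HB.instance Definition _ k :=
  GRing.isSubmodClosed.Build R cochain (cocycle k) (cocycle_closed k).

Record cocycles k := Cocycle
  { cocycle_val :> cochain; _ : cocycle_val \in cocycle k }.
HB.instance Definition _ k := [isSub for @cocycle_val k].
HB.instance Definition _ k := [Choice of cocycles k by <:].
HB.instance Definition _ k := [SubChoice_isSubLmodule of cocycles k by <:].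

(* For k = 0 only b = 0 satisfies the degree condition. *)
Definition coboundary k : {pred cocycles k} :=
  fun z => `[< exists b, (forall S, #|S|.+1 != k -> b S = 0) /\
                         cocycle_val z = cech_d b >].

Fact coboundary_closed k : submod_closed (@coboundary k).
Proof.
split=> [|a z z' /asboolP[b [bk zb]] /asboolP[b' [bk' zb']]]; apply/asboolP.
  by exists 0; split=> [S _|]; rewrite ?dprod0E ?linear0.
exists (a *: b + b'); split=> [S Sk|].
  by rewrite dprodDE dprodZE bk // bk' // scaler0 addr0.
by rewrite linearP /= -zb -zb'.
Qed.
HB.instance Definition _ k := GRing.isSubmodClosed.Build R (cocycles k)
  (@coboundary k) (@coboundary_closed k).

Definition cech_cohomology (k : nat) : lmodType R := quotmod (@coboundary k).

End CechComplex.

Definition generates (R : comNzRingType) (n : nat) (f : 'I_n -> R)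
    (a : {pred R}) : Prop :=
  forall r : R, r \in a <-> exists c : 'I_n -> R, r = \sum_(j < n) c j * f j.

Section Invariants.
Variables (F : fieldType) (gT : finGroupType) (G : {group gT}) (n : nat).
Variable rG : mx_representation F G n.
Local Notation P := {mpoly F[n]}.

(* g sends x_j to the linear form with coefficients the j-th column of the
   matrix of g; this is a left action. *)
Definition lin_form (g : gT) (j : 'I_n) : P := \sum_(i < n) rG g i j *: 'X_i.
Definition poly_act (g : gT) (p : P) : P := p \mPo [tuple lin_form g j | j < n].

Lemma poly_act1 p : poly_act 1%g p = p.
Proof.
rewrite /poly_act -[RHS]comp_mpoly_id; congr (_ \mPo _); apply: eq_mktuple.
move=> j; rewrite /lin_form repr_mx1 (bigD1 j) //= mxE eqxx scale1r.
rewrite big1 ?addr0 // => i ij; by rewrite mxE (negPf ij) scale0r.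
Qed.

Lemma poly_actM g h p : g \in G -> h \in G ->
  poly_act (g * h)%g p = poly_act g (poly_act h p).
Proof.
move=> gG hG; rewrite {1 3}/poly_act !comp_mpolyE /poly_act linear_sum /=.
apply: eq_bigr => m _; rewrite comp_mpolyZ rmorph_prod; congr (_ *: _).
apply: eq_bigr => j _; rewrite rmorphXn /= !tnth_mktuple; congr (_ ^+ _).
rewrite /lin_form linear_sum /=.
under [RHS]eq_bigr => l _ do
  rewrite comp_mpolyZ comp_mpolyXU -tnth_nth tnth_mktuple scaler_sumr.
rewrite exchange_big /=; apply: eq_bigr => i _; rewrite repr_mxM // mxE.
by rewrite scaler_suml; apply: eq_bigr => l _; rewrite scalerA mulrC.
Qed.

Definition invariant : {pred P} :=
  [pred p | [forall g in G, poly_act g p == p]].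

Fact invariant_closed : subring_closed invariant.
Proof.
split=> [|p q /forall_inP hp /forall_inP hq|p q /forall_inP hp /forall_inP hq];
  apply/forall_inP=> g gG; rewrite /poly_act ?rmorph1 //.
  by rewrite rmorphB /= -!/(poly_act _ _) (eqP (hp g gG)) (eqP (hq g gG)).
by rewrite rmorphM /= -!/(poly_act _ _) (eqP (hp g gG)) (eqP (hq g gG)).
Qed.
HB.instance Definition _ :=
  GRing.isSubringClosed.Build P invariant invariant_closed.

Record invring := InvRing { invring_val :> P; _ : invring_val \in invariant }.
HB.instance Definition _ := [isSub for invring_val].
HB.instance Definition _ := [Choice of invring by <:].
HB.instance Definition _ := [SubChoice_isSubComNzRing of invring by <:].

Lemma poly_act_homog d g p :
  p \is d.-homog -> poly_act g p \is d.-homog.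
Proof.
move=> /dhomogP hp; rewrite /poly_act comp_mpolyE big_seq.
apply: rpred_sum => m /hp <-; apply: rpredZ => /=; rewrite mdegE.
elim/big_rec2: _ => [|i q e _ hq]; first exact: dhomog1.
rewrite tnth_mktuple; apply: dhomogM => //.
rewrite -[X in X.-homog]mul1n; apply: dhomogMn.
by apply: rpred_sum => l _; apply: rpredZ; rewrite dhomogX /= mdeg1.
Qed.

Lemma pihomog_act d g p :
  pihomog [measure of mdeg] d (poly_act g p) =
  poly_act g (pihomog [measure of mdeg] d p).
Proof.
have ph e (q : P) : q \is e.-homog ->
    pihomog [measure of mdeg] d q = if e == d then q else 0.
  by case: eqVneq => [<-|ed] hq; [exact: pihomog_dE | exact: pihomog_ne0 hq].
rewrite {1 2}(pihomog_partitionE (leqnn (mmeasure mdeg p))).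
rewrite /poly_act (linear_sum (comp_mpoly _)) !(linear_sum (pihomog _ d)) /=.
rewrite (linear_sum (comp_mpoly _)) /=; apply: eq_bigr => e _.
have he := pihomogP [measure of mdeg] e p.
rewrite (ph e _ (poly_act_homog g he)) (ph e _ he).
by case: eqP => // _; rewrite linear0.
Qed.

Fact pihomog_invariant d (p : invring) :
  pihomog [measure of mdeg] d (val p) \in invariant.
Proof.
case: p => p /= /forall_inP hp; apply/forall_inP => g gG.
by rewrite -pihomog_act (eqP (hp g gG)).
Qed.

Definition hcomp (d : nat) (p : invring) : invring :=
  InvRing (pihomog_invariant d p).

Definition homogeneous (a : {pred invring}) : Prop :=
  forall p, p \in a -> forall d, hcomp d p \in a.

End Invariants.

(* Main.v *)
(* Let S be the polynomial ring, so that R = S^G, and let v be a nonzero vector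
   fixed by a Sylow p-subgroup of G (any nonzero vector in characteristic 0).
   The stabilizer H of v has index invertible in F, so H^i_a(R) is a direct
   summand of H^i_a(S^H) via the transfer. As v is fixed by H, all the divided
   powers of the derivation along v act on S^H, on its localizations and on
   H^i_a(S^H); by the Leibniz rule the annihilator J of H^i_a(S^H) in S^H is
   stable under them. Hence H^i_a(S^H) = 0 as soon as J contains some w such that
   w(x + t v) has a nonzero constant as leading coefficient in t.
   If H^i_a(R) has finite length it is killed by a product of maximal ideals of
   R, hence by q(h) for a monic polynomial q over F, where h in R is homogeneous
   of positive degree with h(v) <> 0 (Zariski's lemma). Since S^G -> S^H is etale
   at v, there are a_l, b_l in S^H and c in S^H homogeneous with c(v) <> 0 such
   that sum_l a_l g(b_l) is c for g in H and 0 for the other g in G; then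
   c z = sum_l a_l tr(b_l z) shows that w = q(h) c is in J. *)
Require Import Defs.
From HB Require Import structures.
From mathcomp Require Import all_boot all_order all_algebra all_fingroup.
From mathcomp Require Import mxrepresentation mxabelem pgroup sylow.
From mathcomp Require Import generic_quotient ring.
From mathcomp Require Import boolp mpoly.

Set Implicit Arguments.
Unset Strict Implicit.
Unset Printing Implicit Defensive.

Import GRing.Theory.
Local Open Scope ring_scope.
Local Open Scope quotient_scope.

(** * Zariski's lemma *)

Section Integrality.
Variables (B : comNzRingType) (K : fieldType) (phi : {rmorphism B -> K}).

Lemma horner_map_wide (p : {poly B}) n k : (size p <= n)%N ->
  (map_poly phi p).[k] = \sum_(i < n) phi p`_i * k ^+ i.
Proof.
move=> spn; rewrite (@horner_coef_wide _ n) ?(leq_trans (size_poly _ _)) //.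
by apply: eq_bigr => i _; rewrite coef_map.
Qed.

(* A monic equation for d / b, multiplied by the right power of b, puts a
   power of d in the ideal generated by b. *)
Lemma integral_quotient_dvd (b d : B) :
  phi b != 0 -> integralOver phi (phi d / phi b) ->
  exists n c, phi b * phi c = phi d ^+ n.
Proof.
move=> b0 [p mp]; set k := _ / _ => pk.
have kb : phi b * k = phi d by rewrite mulrCA divff ?mulr1.
have sp : size p = (size p).-1.+1 by rewrite prednK // size_poly_gt0 monic_neq0.
set n := (size p).-1 in sp.
exists n, (- \sum_(i < n) p`_i * d ^+ i * b ^+ (n - i.+1)).
move: pk; rewrite /root (@horner_map_wide _ n.+1) ?sp // big_ord_recr /=.
rewrite -[p`_n]/(lead_coef p) (monicP mp) rmorph1 mul1r addrC addr_eq0 => /eqP pk.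
rewrite -kb exprMn pk rmorphN !mulrN mulr_sumr rmorph_sum mulr_sumr.
congr (- _); apply: eq_bigr => i _.
rewrite !rmorphM !rmorphXn -kb exprMn.
have -> : phi b ^+ n = phi b ^+ i * phi b ^+ (n - i.+1).+1.
  by rewrite -exprD addnS -addSn subnKC.
by rewrite exprS; ring.
Qed.

Lemma integral_exp k n : integralOver phi k -> integralOver phi (k ^+ n).
Proof.
move=> ik; elim: n => [|n IHn]; first exact: integral1.
by rewrite exprS; apply: integral_mul.
Qed.

Lemma integral_sum (I : Type) (r : seq I) (P : pred I) (E : I -> K) :
  (forall i, P i -> integralOver phi (E i)) ->
  integralOver phi (\sum_(i <- r | P i) E i).
Proof.
move=> iE; elim/big_rec: _ => [|i x Pi]; first exact: integral0.
by apply: integral_add; apply: iE.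
Qed.

(** Induction on the degree of a monic equation [q * 'X + e] of [k]. If [phi e] vanishes, [k]
    cancels and [q] is a shorter equation; otherwise [phi e / k] is minus the value of [q] at [k], a
    polynomial in an integral element. *)
Lemma integral_denominator_inv k : k != 0 -> integralOver phi k ->
  exists2 e, phi e != 0 & integralOver phi (phi e / k).
Proof.
move=> k0 [p mp]; have [n] := ubnP (size p).
elim: n p mp => // n IHn p mp; rewrite ltnS => spn.
have [q [e pE]] : exists q e, p = q * 'X + e%:P.
  elim/poly_ind: p {mp spn} => [|q e _]; last by exists q, e.
  by exists 0, 0; rewrite mul0r addr0.
have [q0|q0] := eqVneq q 0.
  rewrite pE q0 mul0r add0r /root map_polyC hornerC => /= /eqP.
  move: mp; rewrite pE q0 mul0r add0r monicE lead_coefC => /eqP->.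
  by rewrite rmorph1 => /eqP; rewrite oner_eq0.
have sq : size p = (size q).+1 by rewrite pE size_MXaddC (negPf q0).
have mq : q \is monic.
  move: mp; rewrite pE !monicE lead_coefDl ?lead_coefMX //.
  by rewrite size_mulX // (leq_ltn_trans (size_polyC_leq1 _)) // ltnS size_poly_gt0.
rewrite pE /root rmorphD rmorphM /= map_polyX map_polyC /=.
rewrite hornerD hornerM hornerX hornerC.
have [->|e0] := eqVneq (phi e) 0.
  by rewrite addr0 mulf_eq0 (negPf k0) orbF => /(IHn q mq); apply; rewrite -sq.
rewrite addrC addr_eq0 => /eqP ek; exists e => //.
rewrite ek -mulNr mulfK //; apply: integral_opp; apply: integral_horner; last first.
  exists p => //; rewrite /root pE rmorphD rmorphM /= map_polyX map_polyC /=.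
  by rewrite hornerD hornerM hornerX hornerC ek subrr.
apply/integral_poly => i; rewrite coef_map; exact: integral_id.
Qed.

(** Multiplying the equation by [c ^+ n], with [c] the leading coefficient and [n.+1] the degree,
    turns it into a monic equation for [c * k]. *)
Lemma integral_lead_coef (p : {poly B}) k : (1 < size p)%N ->
  root (map_poly phi p) k -> integralOver phi (phi (lead_coef p) * k).
Proof.
move=> sp; have spE : size p = (size p).-2.+2 by case: (size p) sp => [|[]].
set n := (size p).-2 in spE; set c := lead_coef p.
have cE : c = p`_n.+1 by rewrite /c lead_coefE spE.
rewrite /root (@horner_map_wide _ n.+2) ?spE // big_ord_recr /= -cE => /eqP pk.
pose q := 'X^(n.+1) + \poly_(i < n.+1) (p`_i * c ^+ (n - i)).
exists q.
  by rewrite monicE lead_coefDl ?lead_coefXn // size_polyXn ltnS size_poly.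
rewrite /root rmorphD /= map_polyXn hornerD hornerXn.
set r := \poly_(_ < _) _.
have -> : (map_poly phi r).[phi c * k] = phi c ^+ n * \sum_(i < n.+1) phi p`_i * k ^+ i.
  rewrite (@horner_coef_wide _ n.+1) ?(leq_trans (size_poly _ _)) ?size_poly //.
  rewrite mulr_sumr; apply: eq_bigr => i _; rewrite coef_map coef_poly ltn_ord /=.
  rewrite rmorphM rmorphXn exprMn.
  have -> : phi c ^+ n = phi c ^+ (n - i) * phi c ^+ i by rewrite -exprD subnK // -ltnS.
  by ring.
by rewrite exprMn exprSr -mulrA -mulrDr addrC pk mulr0.
Qed.
End Integrality.

(* The image of phi becomes a field after inverting one nonzero element. *)
Definition almost_field (B : comNzRingType) (K : fieldType) (phi : B -> K) :=
  exists2 s, phi s != 0 &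
    forall b, phi b != 0 -> exists n c, phi b * phi c = phi s ^+ n.

(** Without such a [p], every relation in [K] would already hold between polynomials over [K]. Then
    [1 + 'X * s] would divide a power of [s] while being coprime to [s], so it would be constant,
    which its degree forbids. *)
Lemma almost_field_algebraic (B : comNzRingType) (K : fieldType)
    (phi : {rmorphism {poly B} -> K}) : almost_field phi ->
  exists2 p, phi p = 0 & map_poly (phi \o polyC) p != 0.
Proof.
move=> [s s0 hs]; apply: contrapT => np.
set f := [the {rmorphism _ -> _} of phi \o polyC].
have inj p : phi p = 0 -> map_poly f p = 0.
  by move=> pp; apply/eqP/negPn/negP => pn; apply: np; exists p.
pose t := map_poly f s.
have t0 : t != 0.
  apply: contraNneq s0 => st.
  have -> : s = \sum_(i < size s) (s : {poly B})`_i *: 'X^i :> {poly B}.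
    by by rewrite -poly_def coefK.
  rewrite rmorph_sum big1 // => i _; rewrite -mul_polyC rmorphM /=.
  have := congr1 (fun p : {poly K} => p`_i) st.
  by rewrite /t coef_map coef0 /= => ->; rewrite mul0r.
have s1t : (1 < size (1 + 'X * t)%R)%N.
  rewrite addrC size_addl ?size_polyC ?oner_eq0 mulrC size_mulX // ltnS.
    by rewrite size_poly_gt0.
  by rewrite size_poly_gt0.
have [b0|] := eqVneq (phi (1 + 'X * s)) 0.
  have := inj _ b0; rewrite rmorphD rmorphM rmorph1 /= map_polyX -/t => t1.
  by move: s1t; rewrite t1 size_poly0.
move=> /hs[n [c]]; rewrite -rmorphM -rmorphXn => /eqP; rewrite -subr_eq0 -rmorphB.
move=> /eqP/inj /eqP; rewrite rmorphB subr_eq0 rmorphM rmorphXn rmorphD.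
rewrite rmorphM rmorph1 /= map_polyX -/t.
move=> /eqP tc; have : coprimep (1 + 'X * t) (t ^+ n).
  apply: coprimep_expr; apply/Bezout_eq1_coprimepP; exists (1, - 'X) => /=; ring.
move=> /coprimepP /(_ (1 + 'X * t) (dvdpp _)); rewrite -tc dvdp_mulr // => /(_ isT).
by rewrite -size_poly_eq1 => /eqP s1; move: s1t; rewrite s1.
Qed.

(* If B[a] is almost a field, so is B: a is algebraic over B by
   almost_field_algebraic, so that B[a] is integral over B after inverting one
   element, and an inverse which is integral over a ring lies in the ring. *)
Lemma almost_field_polyC (B : comNzRingType) (K : fieldType)
    (phi : {rmorphism {poly B} -> K}) :
  almost_field phi -> almost_field (phi \o polyC).
Proof.
move=> aphi; have [p pp pn] := almost_field_algebraic aphi.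
case: aphi => s s0 hs.
set f := [the {rmorphism _ -> _} of phi \o polyC] in pn *.
pose a := phi 'X.
have phiE (q : {poly B}) : phi q = (map_poly f q).[a].
  rewrite (@horner_map_wide _ _ _ _ (size q)) // -{1}[q]coefK poly_def rmorph_sum.
  by apply: eq_bigr => i _; rewrite -mul_polyC rmorphM rmorphXn.
(* [phi] may kill leading coefficients of [p]; dropping them leaves an equation of [a] whose leading
   coefficient is nonzero in [K]. *)
pose m := size (map_poly f p); pose r := \poly_(i < m) p`_i.
have rE : map_poly f r = map_poly f p.
  apply/polyP => i; rewrite !coef_map coef_poly; case: ltnP => // le_mi.
  by rewrite /= rmorph0; have := nth_default 0 le_mi; rewrite coef_map /= => ->.
have m0 : (0 < m)%N by rewrite size_poly_gt0.
have lr0 : f p`_m.-1 != 0 by rewrite -lead_coef_eq0 lead_coefE coef_map in pn.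
have pm0 : p`_m.-1 != 0 by apply: contraNneq lr0 => ->; rewrite rmorph0.
have sr : size r = m by rewrite size_poly_eq.
have m1 : (1 < m)%N.
  rewrite ltn_neqAle m0 andbT eq_sym; apply/negP => /size_poly1P[c c0 pc].
  by move: pp c0; rewrite phiE pc hornerC => ->; rewrite eqxx.
have ca : integralOver f (f (lead_coef r) * a).
  by apply: integral_lead_coef; rewrite ?sr // /root rE -phiE pp.
have lcr : lead_coef r = p`_m.-1 by rewrite lead_coefE sr coef_poly prednK // leqnn.
set c := lead_coef r in ca; have c0 : f c != 0 by rewrite /c lcr.
(* As [f c * a] is integral, [f c ^+ n] makes any polynomial expression in [a] of degree at most [n]
   integral. *)
have intq (q : {poly B}) n : (size q <= n.+1)%N -> integralOver f (phi q * f c ^+ n).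
  move=> sq; rewrite phiE (@horner_map_wide _ _ _ _ n.+1) // mulr_suml.
  apply: integral_sum => i _.
  have -> : f q`_i * a ^+ i * f c ^+ n = f (q`_i * c ^+ (n - i)) * (f c * a) ^+ i.
    rewrite rmorphM rmorphXn exprMn.
    have -> : f c ^+ n = f c ^+ (n - i) * f c ^+ i by rewrite -exprD subnK // -ltnS.
    ring.
  by apply: integral_mul; [exact: integral_id | exact: integral_exp].
pose sg := phi s * f c ^+ (size s).
have sg0 : sg != 0 by rewrite mulf_neq0 ?expf_neq0.
have [e e0 ie] := integral_denominator_inv sg0 (intq s _ (leqnSn _)).
(* Inverting [c] makes [a] integral, and inverting [e] makes the inverse of [sg], hence that of
   [phi s], integral. *)
exists (c * e); first by rewrite rmorphM mulf_neq0.
move=> b b0; have [n [d bd]] := hs _ b0.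
pose L := (n + size d)%N.
(* [1 / f b] equals [phi d / phi s ^+ n]; the exponent [L] suffices to clear the denominators both
   of [phi d] and of [1 / phi s ^+ n]. *)
have : integralOver f (f ((c * e) ^+ L) / f b).
  have -> : f ((c * e) ^+ L) / f b = phi d * f c ^+ size d * (f e / sg) ^+ n *
      f (c ^+ (size s * n) * c ^+ n * e ^+ size d).
    have bV : (f b)^-1 = phi d / phi s ^+ n.
      by apply: (mulfI b0); rewrite mulfV // mulrA [_ * phi d]bd mulfV // expf_neq0.
    rewrite bV /sg !rmorphM !rmorphXn rmorphM.
    move: (f e) (f c) (phi s) (phi d) c0 s0 => E C T D c0 s0.
    rewrite expr_div_n !exprMn -exprM /L !exprD.
    field; rewrite ?expf_neq0 //.
  apply: integral_mul; last exact: integral_id.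
  by apply: integral_mul; [exact: intq | exact: integral_exp].
move=> /(integral_quotient_dvd b0)[k [g bg]]; exists (L * k)%N, g.
by rewrite exprM -rmorphXn bg.
Qed.

(** [B'] is an iterated polynomial ring over [B] whose variables are sent to the elements of [ys];
    [almost_field_polyC] removes them one at a time. *)
Lemma adjoin_almost_field (R : comNzRingType) (K : fieldType)
    (pi : {rmorphism R -> K}) (ys : seq R) (B : comNzRingType)
    (phi : {rmorphism B -> R}) :
  exists (B' : comNzRingType) (phi' : {rmorphism B' -> R}),
    [/\ forall b, exists b', phi' b' = phi b,
        forall y, y \in ys -> exists b', phi' b' = y
      & almost_field (pi \o phi') -> almost_field (pi \o phi)].
Proof.
elim: ys B phi => [|y ys IHys] B phi; first by exists B, phi; split=> // b; exists b.
have cf : commr_rmorph phi y by move=> b; apply: mulrC.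
have [B' [phi' [phiB phiy afB]]] := IHys {poly B} (horner_morph cf).
exists B', phi'; split=> [b|z|/afB].
- by have [b' hb] := phiB b%:P; exists b'; rewrite hb /= horner_morphC.
- rewrite inE => /predU1P[->|/phiy //].
  by have [b' hb] := phiB 'X; exists b'; rewrite hb /= horner_morphX.
move=> /(almost_field_polyC (phi := [the {rmorphism _ -> _} of pi \o horner_morph cf])).
case=> s /= s0 hs; exists s; first by rewrite /= -(horner_morphC cf).
by move=> b; rewrite /= -(horner_morphC cf) => /hs[n [c hc]]; exists n, c;
  rewrite /= -!(horner_morphC cf).
Qed.

(* The second hypothesis says that R is integral over the F-subalgebra
   generated by ys: B -> R is any map whose image contains F and ys. *)
Lemma zariski (F : fieldType) (R : comNzRingType) (K : fieldType)
    (iota : {rmorphism F -> R}) (pi : {rmorphism R -> K}) (ys : seq R) (h : R) :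
  (forall k : K, exists r, pi r = k) ->
  (forall (B : comNzRingType) (phi : {rmorphism B -> R}),
     (forall a, exists b, phi b = iota a) ->
     (forall y, y \in ys -> exists b, phi b = y) ->
     forall r, integralOver phi r) ->
  exists2 q : {poly F}, q \is monic & pi (map_poly iota q).[h] = 0.
Proof.
move=> surj intR.
have ch : commr_rmorph iota h by move=> b; apply: mulrC.
(* The tower starts from [{poly F}], whose variable is sent to [h], so that removing [ys] leaves a
   statement on polynomials in [h]. *)
have [B [phi [phiF phiy afB]]] :=
  adjoin_almost_field pi ys [the {rmorphism {poly F} -> R} of horner_morph ch].
have {}intR : forall r, integralOver phi r.
  apply: intR => // a; have [b hb] := phiF a%:P; exists b.
  by rewrite hb /= horner_morphC.
(* The field [K] is integral over the image of [B], so this image is itself a field and [1] serves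
   as the element to invert. Descending to [{poly F}], the image of [h] is algebraic over [F]. *)
have {afB} /almost_field_algebraic[] : almost_field (pi \o horner_morph ch).
  apply: afB; exists 1 => [|b b0]; first by rewrite rmorph1 oner_eq0.
  have [r rb] := surj ((pi \o phi) 1 / (pi \o phi) b).
  have : integralOver (pi \o phi) (pi r) by apply: integral_rmorph.
  by rewrite rb => /(integral_quotient_dvd b0).
move=> p /= pp mp0; have {mp0} p0 : p != 0.
  by apply: contraNneq mp0 => ->; rewrite map_poly0.
exists ((lead_coef p)^-1 *: p); first by rewrite monicE lead_coefZ mulVf ?lead_coef_eq0.
by rewrite map_polyZ /= hornerZ rmorphM [X in _ * X]pp mulr0.
Qed.

(** The hypotheses express elementwise that [I] is a maximal ideal; [K] is the quotient [R / I]. *)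
Lemma residue_field (R : comNzRingType) (I : {pred R}) :
  0 \in I -> (forall a b, a \in I -> b \in I -> a + b \in I) ->
  (forall a b, b \in I -> a * b \in I) -> 1 \notin I ->
  (forall a, a \notin I -> exists b, 1 - b * a \in I) ->
  exists (K : fieldType) (pi : {rmorphism R -> K}),
    (forall k, exists r, pi r = k) /\ (forall r, pi r = 0 -> r \in I).
Proof.
move=> I0 ID IM I1 IV.
have Icl : idealr_closed I by split=> // a u v uI vI; apply: ID => //; apply: IM.
pose J : idealr R := HB.pack I (isIdealr.Build R I Icl).
pose Q := {ideal_quot J}.
have surj (k : Q) : exists r, \pi_Q r = k by exists (repr k); rewrite reprK.
have pi0 r : (\pi_Q r == 0) = (r \in I).
  by rewrite -[0](rmorph0 (\pi_Q)) -Quotient.idealrBE subr0.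
have inv (k : Q) : exists k', (k != 0 -> k' * k = 1) /\ (k = 0 -> k' = 0).
  have [->|k0] := eqVneq k 0; first by exists 0; split=> // /eqP.
  have [r rk] := surj k; have [|b hb] := IV r; first by rewrite -pi0 rk.
  exists (\pi_Q b); split=> [_|/eqP]; last by rewrite (negPf k0).
  apply/esym/eqP; rewrite -subr_eq0 -rk -rmorphM -[1](rmorph1 (\pi_Q)) -rmorphB pi0.
  exact: hb.
have [f hf] := choice inv.
pose K : fieldType := HB.pack Q
  (GRing.ComNzRing_isField.Build Q (fun k => (hf k).1) ((hf 0).2 erefl)).
exists K, [the {rmorphism R -> Q} of \pi_Q].
by split=> // r /eqP; rewrite pi0.
Qed.

(** * Modules of finite length *)

(** Induction along the composition series: a simple factor is [R / I] for a maximal ideal [I],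
    which contains a monic polynomial in [h] by [zariski]. The product of these polynomials kills
    [M]. *)
Lemma finite_length_annihilator (F : fieldType) (R : comNzRingType)
    (iota : {rmorphism F -> R}) (ys : seq R) (h : R) (M : lmodType R) :
  (forall (B : comNzRingType) (phi : {rmorphism B -> R}),
     (forall a, exists b, phi b = iota a) ->
     (forall y, y \in ys -> exists b, phi b = y) ->
     forall r, integralOver phi r) ->
  finite_length M ->
  exists2 q : {poly F}, q \is monic &
    forall x : M, (map_poly iota q).[h] *: x = 0.
Proof.
move=> intR [l [N [Ncl N0 Nl Nmax]]].
suff chain k : (k <= l)%N -> exists2 q : {poly F}, q \is monic &
    forall x, x \in N k -> (map_poly iota q).[h] *: x = 0.
  by have [q mq hq] := chain l (leqnn l); exists q => // x; apply: hq; rewrite Nl.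
elim: k => [|k IHk] kl.
  by exists 1 => [|x]; rewrite ?monic1 // N0 inE => /eqP->; rewrite scaler0.
have [q mq hq] := IHk (ltnW kl).
have [sub [x xN' xN] hmax] := Nmax k kl.
have clD j a u w : u \in N j -> w \in N j -> a *: u + w \in N j.
  by case: (Ncl j) => _; apply.
have cl0 j : 0 \in N j by case: (Ncl j).
have clZ j a u : u \in N j -> a *: u \in N j.
  by move=> uN; rewrite -[_ *: _]addr0; apply: clD.
pose I := [pred r : R | r *: x \in N k].
(* By simplicity, a multiple [r *: x] outside [N k] generates [N k.+1] modulo [N k]. Hence [I] is
   maximal and, for [r = 1], [x] generates the factor. *)
have gen r y : r *: x \notin N k -> y \in N k.+1 ->
    exists n a, n \in N k /\ y = n + a *: (r *: x).
  move=> rx yN'.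
  pose L := [pred z | `[< exists n a, n \in N k /\ z = n + a *: (r *: x) >]].
  have Lcl : submod_closed L.
    split=> [|a u w /asboolP[n [b [nN ->]]] /asboolP[n' [b' [nN' ->]]]]; apply/asboolP.
      by exists 0, 0; rewrite scale0r addr0.
    exists (a *: n + n'), (a * b + b'); split; first exact: clD.
    by rewrite scalerDr scalerDl -!scalerA addrACA.
  have [|z|LN|LN] := hmax L Lcl.
  - by move=> z zN; apply/asboolP; exists z, 0; rewrite scale0r addr0.
  - move=> /asboolP[n [a [nN ->]]]; rewrite addrC; apply: clD; last exact: sub.
    exact: clZ.
  - by case/negP: rx; rewrite -LN; apply/asboolP; exists 0, 1; rewrite add0r scale1r.
  - by have /asboolP : y \in L by rewrite LN.
have [||||a aI|K [pi [surj piI]]] := @residue_field R I.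
- by rewrite inE scale0r.
- by move=> a b aI bI; rewrite inE scalerDl -[a *: x]scale1r; apply: clD.
- by move=> a b bI; rewrite inE -scalerA; apply: clZ.
- by rewrite inE scale1r.
- have [n [b [nN xE]]] := gen a x aI xN'; exists b.
  by rewrite inE scalerBl scale1r -scalerA {1}xE addrK.
have [q' mq' hq'] := zariski h surj intR.
exists (q * q') => [|y yN']; first by rewrite monicMl.
have [|n [a [nN ->]]] := gen 1 y _ yN'; first by rewrite scale1r.
rewrite scale1r rmorphM hornerM -scalerA; apply: hq.
rewrite scalerDr scalerA mulrC -scalerA.
by rewrite addrC; apply: clD; [exact: piI | exact: clZ].
Qed.

(** * The Cech complex in a fraction field *)

(* Over a domain with fraction field K, a Cech cochain is a family of elements
   of K, of which only the components at the S with x_S <> 0 matter: the other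
   localizations vanish. *)
Section FieldCech.
Variables (K : fieldType) (m : nat) (x : 'I_m -> K).
Implicit Types (A : K -> Prop) (c z : {set 'I_m} -> K).

Definition fprod (S : {set 'I_m}) : K := \prod_(j in S) x j.

(** Membership in the localization [A[1/y]], as a subset of [K]. *)
Definition locin A (y k : K) : Prop := exists N, A (k * y ^+ N).

Definition fcochain A c : Prop := forall S, fprod S != 0 -> locin A (fprod S) (c S).

Definition fdiff c (S : {set 'I_m}) : K :=
  \sum_(j in S) (-1) ^+ cech_sign S j * c (S :\ j).

Definition fcocycle A k z : Prop :=
  [/\ fcochain A z, forall S : {set 'I_m}, #|S| != k -> z S = 0 &
      forall S, fprod S != 0 -> fdiff z S = 0].

Definition fcoboundary A k z : Prop :=
  exists c, [/\ fcochain A c, forall S : {set 'I_m}, #|S|.+1 != k -> c S = 0 &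
      forall S, fprod S != 0 -> z S = fdiff c S].

Lemma fprodD1 (S : {set 'I_m}) j : j \in S -> fprod S = fprod (S :\ j) * x j.
Proof. by move=> jS; rewrite /fprod (big_setD1 j) // mulrC. Qed.

End FieldCech.

(** * The Cech complex of a domain as families of fractions *)

Section Bridge.
Variables (R : comNzRingType) (K : fieldType) (inc : {rmorphism R -> K}).
Hypothesis inc_inj : injective inc.
Variables (m : nat) (f : 'I_m -> R).
Local Notation x := (fun j => inc (f j)).
Local Notation A := (fun k : K => exists r, k = inc r).
Local Notation M := (R^o : lmodType R).

(** The chosen representative is immaterial when [inc y] is nonzero, by [emb_frac]; otherwise the
    localization is zero and the value has no meaning. *)
Definition emb (y : R) (p : loc M y) : K :=
  inc (repr p).1 / inc y ^+ (repr p).2.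

Lemma emb_frac y u k : inc y != 0 -> emb (loc_frac y (u : M) k) = inc u / inc y ^+ k.
Proof.
move=> y0; rewrite /emb; have [n] := repr_loc y (u : M) k.
move: (repr _) => -[u' k'] /= /(congr1 inc).
rewrite rmorph0 !(rmorphM, rmorphB, rmorphXn) /= => /eqP.
rewrite mulf_eq0 expf_eq0 (negPf y0) andbF /= subr_eq0 => /eqP e.
by apply/eqP; rewrite eqr_div ?expf_neq0 // mulrC e mulrC.
Qed.

Lemma emb_linear y a (p q : loc M y) : inc y != 0 ->
  emb (a *: p + q) = inc a * emb p + emb q.
Proof.
move=> y0; elim/loc_frac_ind: p => u k; elim/loc_frac_ind: q => v l.
rewrite -loc_fracZ [_ + _]loc_addE !emb_frac //.
rewrite !(rmorphD, rmorphM, rmorphXn) /= exprD.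
by field; rewrite !expf_neq0.
Qed.

Lemma emb0 y : inc y != 0 -> emb (0 : loc M y) = 0.
Proof. by move=> y0; rewrite -(loc_frac0 _ y 0) emb_frac // rmorph0 mul0r. Qed.

Lemma embD y (p q : loc M y) : inc y != 0 -> emb (p + q) = emb p + emb q.
Proof. by move=> y0; rewrite -[p]scale1r emb_linear // rmorph1 mul1r scale1r. Qed.

Lemma embZ y a (p : loc M y) : inc y != 0 -> emb (a *: p) = inc a * emb p.
Proof. by move=> y0; rewrite -[_ *: p]addr0 emb_linear // emb0 // addr0. Qed.

Lemma emb_inj y (p q : loc M y) : inc y != 0 -> emb p = emb q -> p = q.
Proof.
move=> y0; elim/loc_frac_ind: p => u k; elim/loc_frac_ind: q => v l.
rewrite !emb_frac // => /eqP; rewrite eqr_div ?expf_neq0 // => /eqP e.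
apply: loc_frac_eq; apply: inc_inj.
by rewrite !rmorphM !rmorphXn /= mulrC e mulrC.
Qed.

Lemma emb_map y y' z (p : loc M y) : y' = y * z -> inc y' != 0 ->
  emb (loc_map y' z p) = emb p.
Proof.
move=> yE y'0; have : inc y != 0 /\ inc z != 0.
  by move: y'0; rewrite yE rmorphM mulf_eq0 negb_or => /andP[].
move=> [y0 z0]; elim/loc_frac_ind: p => u k.
rewrite (loc_mapE yE) !emb_frac // yE !rmorphM rmorphXn exprMn.
by field; rewrite !expf_neq0.
Qed.

Lemma loc_zero y (p q : loc M y) : inc y = 0 -> p = q.
Proof.
move=> y0; have {}y0 : y = 0 by apply: inc_inj; rewrite y0 rmorph0.
elim/loc_frac_ind: p => u k; elim/loc_frac_ind: q => v l.
by apply/loc_fracP; exists 1%N; rewrite y0 scale0r.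
Qed.

Lemma fprodE S : fprod x S = inc (cech_prod f S).
Proof. by rewrite /cech_prod rmorph_prod. Qed.

Definition femb (c : cochain f M) (S : {set 'I_m}) : K :=
  if fprod x S == 0 then 0 else emb (c S).

Lemma femb_cochain c : fcochain x A (femb c).
Proof.
move=> S S0; rewrite /femb (negPf S0); move: S0; rewrite fprodE.
elim/loc_frac_ind: (c S) => u k S0.
exists k, u; rewrite emb_frac //.
by rewrite mulfVK // expf_neq0.
Qed.

Lemma femb_diff c S : fprod x S != 0 -> femb (cech_d c) S = fdiff (femb c) S.
Proof.
move=> S0; rewrite /femb (negPf S0) ffunE; rewrite fprodE in S0.
have -> : emb (\sum_(j in S) (-1) ^+ cech_sign S j *:
    loc_map (cech_prod f S) (f j) (c (S :\ j))) =
  \sum_(j in S) emb ((-1) ^+ cech_sign S j *: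
    loc_map (cech_prod f S) (f j) (c (S :\ j))).
  by apply: (big_morph (@emb _)) => [p q|]; rewrite ?embD ?emb0.
apply: eq_bigr => j jS; rewrite embZ // rmorphXn rmorphN1.
rewrite (emb_map _ (cech_prodD1 _ jS)) //.
case: eqP => // Sj0; case/negP: S0.
by rewrite -fprodE (fprodD1 _ jS) Sj0 mul0r.
Qed.

(** The second property carries the degree conditions on [c] over to [C]. *)
Lemma femb_surj c : fcochain x A c -> exists C : cochain f M,
  (forall S, fprod x S != 0 -> femb C S = c S) /\ (forall S, c S = 0 -> C S = 0).
Proof.
move=> cA; have hS S : exists p : loc M (cech_prod f S),
    (fprod x S != 0 -> emb p = c S) /\ (c S = 0 -> p = 0).
  have [S0|S0] := eqVneq (fprod x S) 0; first by exists 0.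
  have [c0|c0] := eqVneq (c S) 0; first by exists 0; rewrite c0 emb0 // -fprodE.
  have [N [r cr]] := cA S S0; exists (loc_frac _ (r : M) N); split=> [_|/eqP].
    by rewrite emb_frac -?fprodE // -cr mulfK // expf_neq0.
  by rewrite (negPf c0).
pose C : cochain f M := [ffun S => projT1 (cid (hS S))].
exists C; split=> S; rewrite /femb ?ffunE; case: (cid _) => p [/= h1 h2] //.
by move=> S0; rewrite (negPf S0) h1.
Qed.

Lemma femb_inj (c c' : cochain f M) :
  (forall S, fprod x S != 0 -> femb c S = femb c' S) -> c = c'.
Proof.
move=> h; apply/ffunP => S; have := h S; rewrite /femb.
case: eqVneq => [S0 _|S0 /(_ isT)]; first by apply: loc_zero; rewrite -fprodE.
by apply: emb_inj; rewrite -fprodE.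
Qed.

Lemma femb_cocycle k (z : cocycles f M k) : fcocycle x A k (femb z).
Proof.
have := valP z; rewrite cocycleE => /andP[/in_degreeP zk /eqP dz].
split=> [|S Sk|S S0]; first exact: femb_cochain.
  rewrite /femb; case: eqVneq => // S0; rewrite [cocycle_val z S]zk // emb0 //.
  by rewrite -fprodE.
rewrite -femb_diff // [cech_d _]dz /femb (negPf S0) dprod0E emb0 //.
by rewrite -fprodE.
Qed.

Lemma femb_coboundary k (z : cocycles f M k) :
  z \in @coboundary _ _ f M k <-> fcoboundary x A k (femb z).
Proof.
split=> [/asboolP[b [bk zb]]|[c [cA ck zc]]].
  exists (femb b); split=> [|S Sk|S S0]; first exact: femb_cochain.
    rewrite /femb; case: eqVneq => // S0; rewrite bk // emb0 //.
    by rewrite -fprodE.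
  by rewrite zb femb_diff.
have [b [bE b0]] := femb_surj cA; apply/asboolP; exists b; split=> [S Sk|].
  by rewrite b0 // ck.
apply: femb_inj => S S0; rewrite femb_diff // zc //; apply: eq_bigr => j jS.
rewrite bE //; rewrite (fprodD1 _ jS) in S0.
by apply: contraNneq S0 => ->; rewrite mul0r.
Qed.

Lemma cohomology_eq0 k (z : cocycles f M k) :
  \pi_(quotmod (@coboundary _ _ f M k)) z = 0 <-> fcoboundary x A k (femb z).
Proof.
set Q := quotmod _; have pi0 : 0 = \pi_Q 0.
  by rewrite -(scale0r (\pi_Q 0)) [LHS]quotmod_scaleE scale0r.
rewrite -femb_coboundary pi0; split=> [/eqP|zb]; last apply/eqP.
  by rewrite pi_quotmodP subr0.
by rewrite pi_quotmodP subr0.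
Qed.

Lemma fcocycle_lift k c : fcocycle x A k c -> exists z : cocycles f M k,
  forall S, fprod x S != 0 -> femb z S = c S.
Proof.
move=> [cA ck dc]; have [C [CE C0]] := femb_surj cA.
have Cz : C \in @cocycle R m f M k.
  rewrite cocycleE; apply/andP; split.
    by apply/in_degreeP => S Sk; rewrite C0 ?ck.
  apply/eqP/femb_inj => S S0.
  rewrite femb_diff // {2}/femb (negPf S0) dprod0E emb0 -?fprodE //.
  rewrite -[RHS](dc S S0); apply: eq_bigr => j jS; rewrite CE //.
  by rewrite (fprodD1 _ jS) in S0; apply: contraNneq S0 => ->; rewrite mul0r.
by exists (Cocycle Cz).
Qed.

Lemma cohomology_vanish k :
  (forall z, fcocycle x A k z -> fcoboundary x A k z) ->
  forall h : cech_cohomology f M k, h = 0.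
Proof.
move=> van h; rewrite -[h]reprK.
by apply/cohomology_eq0/van/femb_cocycle.
Qed.

Lemma cohomology_annihilator k (r : R) :
  (forall h : cech_cohomology f M k, r *: h = 0) ->
  forall z, fcocycle x A k z -> fcoboundary x A k (fun S => inc r * z S).
Proof.
move=> ann z /fcocycle_lift[Z ZE].
have := ann (\pi_(quotmod _) Z); rewrite [r *: _]quotmod_scaleE.
move=> /cohomology_eq0[c [cA ck Zc]]; exists c; split=> // S S0.
by rewrite -Zc // -ZE // /femb (negPf S0) dprodZE embZ // -fprodE.
Qed.
End Bridge.

(** * Additive operators on Cech cocycles and annihilators of cohomology *)

Section CechOperators.
Variables (K : fieldType) (m : nat) (x : 'I_m -> K).
Implicit Types (A : K -> Prop) (z : {set 'I_m} -> K).

(** The exponent of the denominator may change: Hasse derivatives raise it. *)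
Definition preserves_loc A A' (Phi : K -> K) : Prop :=
  forall S, fprod x S != 0 -> forall k,
    locin A (fprod x S) k -> locin A' (fprod x S) (Phi k).

Lemma additive_fun0 (Phi : K -> K) : {morph Phi : a b / a + b} -> Phi 0 = 0.
Proof. by move=> PhiD; apply: (addrI (Phi 0)); rewrite -PhiD !addr0. Qed.

Lemma fdiff_map (Phi : K -> K) z S : {morph Phi : a b / a + b} ->
  fdiff (fun T => Phi (z T)) S = Phi (fdiff z S).
Proof.
move=> PhiD; have Phi0 := additive_fun0 PhiD; rewrite /fdiff (big_morph Phi PhiD Phi0).
apply: eq_bigr => j _; rewrite -signr_odd; case: odd; last by rewrite !mul1r.
by rewrite !mulN1r; apply/eqP; rewrite eq_sym -addr_eq0 -PhiD addNr Phi0.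
Qed.

Lemma fcocycle_map A A' k (Phi : K -> K) z : {morph Phi : a b / a + b} ->
  preserves_loc A A' Phi -> fcocycle x A k z ->
  fcocycle x A' k (fun S => Phi (z S)).
Proof.
move=> PhiD PhiA [zA zk dz]; have Phi0 := additive_fun0 PhiD; split=> [S S0|S Sk|S S0].
- exact/PhiA/zA.
- by rewrite zk.
- by rewrite fdiff_map // dz.
Qed.

Lemma fcoboundary_map A A' k (Phi : K -> K) z : {morph Phi : a b / a + b} ->
  preserves_loc A A' Phi -> fcoboundary x A k z ->
  fcoboundary x A' k (fun S => Phi (z S)).
Proof.
move=> PhiD PhiA [c [cA ck zc]]; have Phi0 := additive_fun0 PhiD.
exists (fun S => Phi (c S)); split=> [S S0|S Sk|S S0].
- exact/PhiA/cA.
- by rewrite ck.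
- by rewrite fdiff_map // zc.
Qed.

Lemma eq_fcoboundary A k z z' :
  (forall S, fprod x S != 0 -> z S = z' S) -> fcoboundary x A k z ->
  fcoboundary x A k z'.
Proof.
by move=> zz' [c [cA ck zc]]; exists c; split=> // S S0; rewrite -zz' ?zc.
Qed.

Section Subring.
Variable A : K -> Prop.
Hypotheses (A0 : A 0) (AN1 : A (- 1)) (AD : forall a b, A a -> A b -> A (a + b)).
Hypotheses (AM : forall a b, A a -> A b -> A (a * b)).
Hypothesis Aprod : forall S, A (fprod x S).

Lemma locin_mul a k S : A a -> locin A (fprod x S) k -> locin A (fprod x S) (a * k).
Proof. by move=> aA [N kA]; exists N; rewrite -mulrA; apply: AM. Qed.

Lemma locin_add k l S : locin A (fprod x S) k -> locin A (fprod x S) l ->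
  locin A (fprod x S) (k + l).
Proof.
have pow a N : A a -> A (a * fprod x S ^+ N).
  by move=> aA; elim: N => [|N IH]; rewrite ?mulr1 // exprSr mulrA; apply: AM.
move=> [N kA] [N' lA]; exists (N + N')%N; rewrite mulrDl; apply: AD.
  by rewrite exprD mulrA; apply: pow.
by rewrite addnC exprD mulrA; apply: pow.
Qed.

Lemma locin0 S : locin A (fprod x S) 0.
Proof. by exists 0%N; rewrite mul0r. Qed.

Lemma fcoboundary_mul k a z : A a -> fcoboundary x A k z ->
  fcoboundary x A k (fun S => a * z S).
Proof.
move=> aA; apply: (@fcoboundary_map A A k (fun u => a * u)) => [u v|S S0 u].
  by rewrite mulrDr.
exact: locin_mul.
Qed.

Lemma fcocycle_mul k a z : A a -> fcocycle x A k z ->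
  fcocycle x A k (fun S => a * z S).
Proof.
move=> aA; apply: (@fcocycle_map A A k (fun u => a * u)) => [u v|S S0 u].
  by rewrite mulrDr.
exact: locin_mul.
Qed.

Lemma fcoboundary_add k z z' : fcoboundary x A k z -> fcoboundary x A k z' ->
  fcoboundary x A k (fun S => z S + z' S).
Proof.
move=> [c [cA ck zc]] [c' [cA' ck' zc']]; exists (fun S => c S + c' S).
split=> [S S0|S Sk|S S0]; first by apply: locin_add; [apply: cA | apply: cA'].
  by rewrite ck // ck' // addr0.
rewrite zc // zc' // /fdiff -big_split; apply: eq_bigr => j _.
by rewrite mulrDr.
Qed.

Lemma fcoboundary_sum k (I : Type) (r : seq I) (P : pred I)
    (z : I -> {set 'I_m} -> K) :
  (forall i, P i -> fcoboundary x A k (z i)) ->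
  fcoboundary x A k (fun S => \sum_(i <- r | P i) z i S).
Proof.
move=> zc; elim: r => [|i r IHr].
  exists (fun=> 0); split=> // [S S0|S S0]; first exact: locin0.
  by rewrite big_nil /fdiff big1 // => j _; rewrite mulr0.
have [Pi|Pi] := boolP (P i); last first.
  by apply: eq_fcoboundary IHr => S _; rewrite big_cons (negPf Pi).
apply: (@eq_fcoboundary _ _ (fun S => z i S + \sum_(i <- r | P i) z i S)).
  by move=> S _; rewrite big_cons Pi.
by apply: fcoboundary_add; first exact: zc.
Qed.

Definition annihilates k (w : K) : Prop := A w /\
  forall z, fcocycle x A k z -> fcoboundary x A k (fun S => w * z S).

(* Leibniz: D b (w z) = sum_(a + a' = b) D a w * D a' z, where D b (w z) is a
   coboundary and, by induction on a < b, so are all the terms but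
   D b w * z. *)
Lemma annihilates_hasse k (D : nat -> K -> K) N w :
  (forall b, (b < N)%N -> {morph D b : u v / u + v}) ->
  (forall b, (b < N)%N -> preserves_loc A A (D b)) ->
  (forall b u, (b < N)%N -> A u -> A (D b u)) ->
  (forall u, D 0 u = u) ->
  (forall b u v, (b < N)%N ->
     D b (u * v) = \sum_(a < b.+1) D a u * D (b - a)%N v) ->
  annihilates k w -> forall b, (b < N)%N -> annihilates k (D b w).
Proof.
move=> DD Dloc DA D0 DM [wA wz] b; elim/ltn_ind: b => b IHb bN.
split=> [|z zc]; first exact: DA.
have rest : fcoboundary x A k
    (fun S => \sum_(a < b) - 1 * (D a w * D (b - a)%N (z S))).
  apply: fcoboundary_sum => a _; apply: fcoboundary_mul => //.
  have [_ haw] := IHb a (ltn_ord a) (ltn_trans (ltn_ord a) bN).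
  apply: (haw (fun S => D (b - a)%N (z S))).
  have baN : (b - a < N)%N by apply: leq_ltn_trans bN; apply: leq_subr.
  by apply: fcocycle_map zc; [apply: DD | apply: Dloc].
have Dwz := fcoboundary_map (DD b bN) (Dloc b bN) (wz z zc).
apply: eq_fcoboundary (fcoboundary_add Dwz rest) => S _.
rewrite DM // big_ord_recr /= subnn D0 addrAC -big_split /= big1 ?add0r // => a _.
by rewrite mulN1r subrr.
Qed.
End Subring.

(** Each [tr (b l * z)] is a cocycle over [A], so [f] makes it a coboundary over [A], hence over
    [A'], where it may be multiplied by [a l]. The sum over [l] is [f * c * z]. *)
Lemma annihilates_transfer A A' k (tr : K -> K) (f c : K) (I : finType)
    (a b : I -> K) :
  A' 0 -> A' (- 1) -> (forall u v, A' u -> A' v -> A' (u + v)) ->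
  (forall u v, A' u -> A' v -> A' (u * v)) -> (forall S, A' (fprod x S)) ->
  (forall u, A u -> A' u) -> {morph tr : u v / u + v} -> preserves_loc A' A tr ->
  (forall l, A' (a l)) -> (forall l, A' (b l)) -> A' c ->
  (forall S u, fprod x S != 0 -> locin A' (fprod x S) u ->
     c * u = \sum_l a l * tr (b l * u)) ->
  annihilates A k f -> annihilates A' k (f * c).
Proof.
move=> A0 AN1 AD AM Aprod AA' trD trA aA bA cA ctr [fA fz]; split.
  by apply: AM => //; apply: AA'.
move=> z zc; have [zA _ _] := zc.
apply: (@eq_fcoboundary A' k (fun S => \sum_l a l * (f * tr (b l * z S)))).
  move=> S S0; rewrite -mulrA (ctr S) //; last exact: zA.
  by rewrite mulr_sumr; apply: eq_bigr => l _; rewrite mulrCA.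
apply: (fcoboundary_sum A0 AD AM Aprod) => l _; apply: (fcoboundary_mul AM) => //.
have [] := fz (fun S => tr (b l * z S)).
  apply: (fcocycle_map trD trA); exact: (fcocycle_mul AM).
move=> y [yA yk zy]; exists y; split=> // S S0.
by have [N h] := yA S S0; exists N; apply: AA'.
Qed.
End CechOperators.

(** * Hasse derivatives on a fraction field *)

Section FractionField.
Variable S : idomainType.
Local Notation K := {fraction S}.
Local Notation "x %:F" := (@FracField.tofrac S x).

Lemma frac_exists (k : K) : exists nd : S * S, nd.2 != 0 /\ k * nd.2%:F = nd.1%:F.
Proof.
case: (repr k) (reprK k) => -[n d] /= d0 <-; exists (n, d); split=> //=.
apply/eqP; rewrite -[_ * _]/(FracField.mul _ _) !piE.
rewrite /FracField.equivf /= /FracField.mulf.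
by rewrite !numden_Ratio ?mulr1 ?oner_eq0 //= ?mul1r mulrC.
Qed.

Definition num (k : K) : S := (projT1 (cid (frac_exists k))).1.
Definition den (k : K) : S := (projT1 (cid (frac_exists k))).2.

Lemma den_neq0 k : den k != 0.
Proof. by rewrite /den; case: cid => nd []. Qed.

Lemma mul_den k : k * (den k)%:F = (num k)%:F.
Proof. by rewrite /den /num; case: cid => nd []. Qed.

Lemma num_den k n d : d != 0 -> k * d%:F = n%:F -> num k * d = n * den k.
Proof.
move=> d0 kd; apply/eqP; rewrite -tofrac_eq !tofracM -kd -mul_den.
by rewrite mulrAC.
Qed.

Section Lift.
Variables (L : fieldType) (phi : {rmorphism S -> L}).
Hypothesis phi_inj : forall s, phi s = 0 -> s = 0.

(** The extension of an injective morphism to the fraction field; [frac_liftE] shows that the chosen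
    fraction does not matter. *)
Definition frac_lift (k : K) : L := phi (num k) / phi (den k).

Let phi_neq0 s : s != 0 -> phi s != 0.
Proof. by apply: contra_neq => /phi_inj. Qed.

Lemma frac_liftE k n d : d != 0 -> k * d%:F = n%:F -> frac_lift k * phi d = phi n.
Proof.
move=> d0 kd; have := congr1 phi (num_den d0 kd); rewrite !rmorphM => nd.
by rewrite /frac_lift mulrAC nd mulfK // phi_neq0 // den_neq0.
Qed.

Lemma frac_lift_tofrac s : frac_lift s%:F = phi s.
Proof.
by rewrite -[LHS]mulr1 -(rmorph1 phi) (@frac_liftE _ s) ?oner_neq0 ?tofrac1 ?mulr1.
Qed.

Lemma frac_liftD : {morph frac_lift : k l / k + l}.
Proof.
move=> k l; have dk := den_neq0 k; have dl := den_neq0 l.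
apply: (mulIf (phi_neq0 (mulf_neq0 dk dl))).
rewrite (@frac_liftE _ (num k * den l + num l * den k)) ?mulf_neq0 //; last first.
  by rewrite tofracD !tofracM -!mul_den; ring.
rewrite rmorphD !rmorphM mulrDl.
rewrite -(frac_liftE dk (mul_den k)) -(frac_liftE dl (mul_den l)).
ring.
Qed.

Lemma frac_liftM : {morph frac_lift : k l / k * l}.
Proof.
move=> k l; have dk := den_neq0 k; have dl := den_neq0 l.
apply: (mulIf (phi_neq0 (mulf_neq0 dk dl))).
rewrite (@frac_liftE _ (num k * num l)) ?mulf_neq0 //; last first.
  by rewrite !tofracM -!mul_den; ring.
rewrite !rmorphM -(frac_liftE dk (mul_den k)) -(frac_liftE dl (mul_den l)).
ring.
Qed.

End Lift.

(* Higher derivations extend to the fraction field: 1 / tau d is computed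
   modulo X ^+ N by a geometric series. *)
Section HasseDerivatives.
Variables (tau : {rmorphism S -> {poly S}}) (N' : nat).
Hypothesis tau0 : forall s, (tau s)`_0 = s.
Local Notation N := N'.+1.

Definition ftau (s : S) : {poly K} := map_poly (@FracField.tofrac S) (tau s).

Definition ftau_inv (d : S) : {poly K} :=
  (d%:F^-1)%:P * \sum_(i < N) (1 - (d%:F^-1)%:P * ftau d) ^+ i.

Definition frac_tau (k : K) : {poly K} := ftau (num k) * ftau_inv (den k).

(** Meaningful for [b < N] only, since the rules for [frac_tau] hold modulo ['X^N]. *)
Definition hasse (b : nat) (k : K) : K := (frac_tau k)`_b.

Definition eqmodX (p q : {poly K}) : bool := 'X^N %| p - q.

Lemma eqmodX_trans p q r : eqmodX p q -> eqmodX q r -> eqmodX p r.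
Proof. by move=> pq qr; rewrite /eqmodX -(subrK q p) -addrA dvdp_add. Qed.

Lemma eqmodX_sym p q : eqmodX p q -> eqmodX q p.
Proof. by move=> pq; rewrite /eqmodX -opprB dvdpNr. Qed.

Lemma eqmodXD p q p' q' : eqmodX p q -> eqmodX p' q' -> eqmodX (p + p') (q + q').
Proof. by move=> pq pq'; rewrite /eqmodX opprD addrACA dvdp_add. Qed.

Lemma eqmodXMr r p q : eqmodX p q -> eqmodX (p * r) (q * r).
Proof. by move=> pq; rewrite /eqmodX -mulrBl dvdp_mulr. Qed.

Lemma eqmodXMl r p q : eqmodX p q -> eqmodX (r * p) (r * q).
Proof. by rewrite ![r * _]mulrC; apply: eqmodXMr. Qed.

Lemma eqmodX_coef p q b : eqmodX p q -> (b < N)%N -> p`_b = q`_b.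
Proof.
by move=> /dvdpP[r pq] bN; rewrite -[p](subrK q) pq coefD coefMXn bN add0r.
Qed.

Lemma ftauM s t : ftau (s * t) = ftau s * ftau t.
Proof. by rewrite /ftau !rmorphM. Qed.

Lemma ftauD s t : ftau (s + t) = ftau s + ftau t.
Proof. by rewrite /ftau !rmorphD. Qed.

(** The product is [1 - e ^+ N] with [e = 1 - ftau d / d], and [e] has zero constant term by
    [tau0]. *)
Lemma ftau_mulV d : d != 0 -> eqmodX (ftau d * ftau_inv d) 1.
Proof.
move=> d0; have dF0 : d%:F != 0 by rewrite tofrac_eq0.
set e := 1 - (d%:F^-1)%:P * ftau d.
have -> : ftau d * ftau_inv d = 1 - e ^+ N.
  rewrite -[RHS]opprB subrX1 -mulNr opprB /ftau_inv -/e.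
  have -> : 1 - e = (d%:F^-1)%:P * ftau d by rewrite /e opprB addrCA subrr addr0.
  ring.
rewrite /eqmodX addrAC subrr add0r dvdpNr; apply: dvdp_exp2r.
rewrite -['X]subr0 -polyC0 dvdp_XsubCl /root horner_coef0 /e.
by rewrite coefB coefCM coef1 coef_map /= tau0 mulVf // subrr.
Qed.

Lemma eqmodX_cancel d p q : d != 0 -> eqmodX (p * ftau d) (q * ftau d) -> eqmodX p q.
Proof.
move=> d0 pq; have h (r : {poly K}) : eqmodX r (r * ftau d * ftau_inv d).
  rewrite -{1}[r]mulr1 -mulrA; apply: eqmodXMl; apply: eqmodX_sym; exact: ftau_mulV.
apply: eqmodX_trans (h p) _; apply: eqmodX_trans (eqmodX_sym (h q)).
exact: eqmodXMr.
Qed.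

Lemma frac_tau_den k : eqmodX (frac_tau k * ftau (den k)) (ftau (num k)).
Proof.
rewrite /frac_tau mulrAC -mulrA -[X in eqmodX _ X]mulr1; apply: eqmodXMl.
exact/ftau_mulV/den_neq0.
Qed.

Lemma frac_tauE k n d : d != 0 -> k * d%:F = n%:F ->
  eqmodX (frac_tau k * ftau d) (ftau n).
Proof.
move=> d0 kd; apply: (eqmodX_cancel (den_neq0 k)).
rewrite -ftauM -(num_den d0 kd) ftauM mulrAC; apply: eqmodXMr; exact: frac_tau_den.
Qed.

Lemma frac_tauD k l : eqmodX (frac_tau (k + l)) (frac_tau k + frac_tau l).
Proof.
have dk := den_neq0 k; have dl := den_neq0 l.
apply: (eqmodX_cancel (mulf_neq0 dk dl)).
apply: (eqmodX_trans (frac_tauE (n := num k * den l + num l * den k) _ _)).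
- by rewrite mulf_neq0.
- by rewrite tofracD !tofracM -!mul_den; ring.
rewrite ftauD !ftauM.
have -> : (frac_tau k + frac_tau l) * (ftau (den k) * ftau (den l)) =
  frac_tau k * ftau (den k) * ftau (den l) +
  frac_tau l * ftau (den l) * ftau (den k) by ring.
apply: eqmodX_sym; apply: eqmodXD; apply: eqmodXMr; exact: frac_tau_den.
Qed.

Lemma frac_tauM k l : eqmodX (frac_tau (k * l)) (frac_tau k * frac_tau l).
Proof.
have dk := den_neq0 k; have dl := den_neq0 l.
apply: (eqmodX_cancel (mulf_neq0 dk dl)).
apply: (eqmodX_trans (frac_tauE (n := num k * num l) _ _)).
- by rewrite mulf_neq0.
- by rewrite !tofracM -!mul_den; ring.
rewrite !ftauM.
have -> : frac_tau k * frac_tau l * (ftau (den k) * ftau (den l)) =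
  (frac_tau k * ftau (den k)) * (frac_tau l * ftau (den l)) by ring.
apply: eqmodX_sym; apply: (eqmodX_trans (eqmodXMr _ (frac_tau_den k))).
exact: eqmodXMl (frac_tau_den l).
Qed.

Lemma frac_tau_tofrac s : eqmodX (frac_tau s%:F) (ftau s).
Proof.
have := @frac_tauE s%:F s 1 (oner_neq0 _); rewrite tofrac1 mulr1.
by rewrite {1}/ftau !rmorph1 mulr1; apply.
Qed.

Lemma hasseD b : (b < N)%N -> {morph hasse b : k l / k + l}.
Proof. by move=> bN k l; rewrite /hasse (eqmodX_coef (frac_tauD k l)) ?coefD. Qed.

Lemma hasseM b k l : (b < N)%N ->
  hasse b (k * l) = \sum_(a < b.+1) hasse a k * hasse (b - a) l.
Proof. by move=> bN; rewrite /hasse (eqmodX_coef (frac_tauM k l)) ?coefM. Qed.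

Lemma hasse_tofrac b s : (b < N)%N -> hasse b s%:F = ((tau s)`_b)%:F.
Proof.
by move=> bN; rewrite /hasse (eqmodX_coef (frac_tau_tofrac s)) ?coef_map.
Qed.

Lemma hasse0 k : hasse 0 k = k.
Proof.
have d0 : (den k)%:F != 0 by rewrite tofrac_eq0 den_neq0.
apply: (mulIf d0); have := eqmodX_coef (frac_tau_den k) (ltn0Sn N').
by rewrite coef0M !coef_map /= !tau0 mul_den.
Qed.

(** With [z = y ^+ M], the truncated geometric series for the inverse of [tau z] has denominators
    dividing [z ^+ N]. Clearing them leaves a polynomial over [B], whence the exponent [M * N]. *)
Lemma hasse_locin (B : subringClosed S) b y k : (b < N)%N ->
  (forall s, s \in B -> tau s \is a polyOver B) -> y \in B -> y != 0 ->
  (exists M s, s \in B /\ k * y%:F ^+ M = s%:F) ->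
  exists M s, s \in B /\ hasse b k * y%:F ^+ M = s%:F.
Proof.
move=> bN tauB yB y0 [M [s [sB ks]]]; exists (M * N)%N.
pose z := y ^+ M; have z0 : z != 0 by rewrite expf_neq0.
have zB : z \in B by rewrite rpredX.
have zF0 : z%:F != 0 by rewrite tofrac_eq0.
pose r := tau s * \sum_(i < N) (z ^+ (N - i.+1))%:P * (z%:P - tau z) ^+ i.
have rB : r \is a polyOver B.
  rewrite rpredM ?tauB // rpred_sum // => i _; rewrite rpredM ?polyOverC ?rpredX //.
  by rewrite rpredB ?polyOverC ?tauB.
exists r`_b; split; first by apply: (polyOverP rB).
have kz : eqmodX (frac_tau k) (ftau s * ftau_inv z).
  apply: (eqmodX_cancel z0); apply: (eqmodX_trans (frac_tauE (n := s) z0 _)).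
    by rewrite tofracXn.
  rewrite mulrAC -mulrA -[X in eqmodX X]mulr1; apply: eqmodXMl.
  exact/eqmodX_sym/ftau_mulV.
rewrite /hasse (eqmodX_coef kz bN) exprM -tofracXn -/z mulrC -coefCM -coef_map.
suff -> : (z%:F ^+ N)%:P * (ftau s * ftau_inv z) =
  map_poly (@FracField.tofrac S) r by [].
have -> : map_poly (@FracField.tofrac S) r = ftau s * map_poly (@FracField.tofrac S)
    (\sum_(i < N) (z ^+ (N - i.+1))%:P * (z%:P - tau z) ^+ i) by rewrite rmorphM.
rewrite mulrCA; congr (ftau s * _).
rewrite /ftau_inv mulrA mulr_sumr rmorph_sum; apply: eq_bigr => i _.
rewrite rmorphM rmorphXn rmorphB /= !map_polyC /= -/(ftau z).
rewrite [X in _ = X%:P * _]rmorphXn.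
have -> : (z%:F)%:P - ftau z = (z%:F)%:P * (1 - (z%:F^-1)%:P * ftau z).
  by rewrite mulrBr mulr1 mulrA -polyCM mulfV // mul1r.
rewrite exprMn mulrA -!polyC_exp -!polyCM; congr (_%:P * _).
by rewrite -exprD subSS subnK ?exprSr ?mulfK // -ltnS.
Qed.

End HasseDerivatives.
End FractionField.

(** * Taylor expansions and homogeneous components *)

(* These maps are locked: otherwise a failing unification of, say,
   evp v p with evp v q unfolds polynomial arithmetic. *)
HB.lock Definition evp (F : fieldType) (n : nat) (v : 'rV[F]_n)
    (p : {mpoly F[n]}) : F := p.@[fun i => v 0 i].

(* p(x + t v), as a polynomial in t. *)
HB.lock Definition taylor (F : fieldType) (n : nat) (v : 'rV[F]_n)
    (p : {mpoly F[n]}) : {poly {mpoly F[n]}} :=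
  mmap (polyC \o @mpolyC n F) (fun i => ('X_i)%:P + (v 0 i)%:MP *: 'X) p.

(* p(t x), as a polynomial in t: its coefficients are the homogeneous
   components of p. *)
HB.lock Definition homog_comps (F : fieldType) (n : nat) (p : {mpoly F[n]}) :
    {poly {mpoly F[n]}} :=
  mmap (polyC \o @mpolyC n F) (fun i => 'X_i *: 'X) p.

Section PolynomialScaling.
Variables (F : fieldType) (n : nat).
Local Notation S := {mpoly F[n]}.

Implicit Types (p q : S) (v : 'rV[F]_n).

Lemma mpoly_ring_ind (P : S -> Prop) :
  (forall c, P c%:MP) -> (forall i, P 'X_i) ->
  (forall p q, P p -> P q -> P (p + q)) -> (forall p q, P p -> P q -> P (p * q)) ->
  forall p, P p.
Proof.
move=> PC PX PD PM p; have P0 : P 0 by rewrite -(mpolyC0 n F).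
rewrite (mpolyE p); apply: (big_ind P) => [|q r|m _] //; first exact: PD.
rewrite -mul_mpolyC mpolyXE_id; apply: (PM) => //.
have P1 : P 1 by rewrite -(mpolyC1 n F).
apply: (big_ind P) => [|q r|i _] //; first exact: PM.
by elim: (m i) => // k Pk; rewrite exprS; apply: PM.
Qed.

Lemma mpoly_rmorph_eq (T : comNzRingType) (f g : {rmorphism S -> T}) :
  (forall c, f c%:MP = g c%:MP) -> (forall i, f 'X_i = g 'X_i) -> f =1 g.
Proof.
move=> fgC fgX; apply: mpoly_ring_ind => // p q fgp fgq.
  by rewrite (rmorphD f) (rmorphD g) fgp fgq.
by rewrite (rmorphM f) (rmorphM g) fgp fgq.
Qed.

Fact evp_zmod v : zmod_morphism (@evp F n v).
Proof. by move=> p q; rewrite !evp.unlock mevalB. Qed.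
Fact evp_monoid v : monoid_morphism (@evp F n v).
Proof. by split=> [|p q]; rewrite !evp.unlock ?meval1 ?mevalM. Qed.
HB.instance Definition _ v := GRing.isZmodMorphism.Build S F (evp v) (evp_zmod v).
HB.instance Definition _ v := GRing.isMonoidMorphism.Build S F (evp v) (evp_monoid v).

Fact taylor_zmod v : zmod_morphism (@taylor F n v).
Proof. by move=> p q; rewrite !taylor.unlock raddfB. Qed.
Fact taylor_monoid v : monoid_morphism (@taylor F n v).
Proof. by split=> [|p q]; rewrite !taylor.unlock ?rmorph1 ?rmorphM. Qed.
HB.instance Definition _ v :=
  GRing.isZmodMorphism.Build S {poly S} (taylor v) (taylor_zmod v).
HB.instance Definition _ v :=
  GRing.isMonoidMorphism.Build S {poly S} (taylor v) (taylor_monoid v).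

Fact homog_comps_zmod : zmod_morphism (@homog_comps F n).
Proof. by move=> p q; rewrite !homog_comps.unlock raddfB. Qed.
Fact homog_comps_monoid : monoid_morphism (@homog_comps F n).
Proof. by split=> [|p q]; rewrite !homog_comps.unlock ?rmorph1 ?rmorphM. Qed.
HB.instance Definition _ :=
  GRing.isZmodMorphism.Build S {poly S} (@homog_comps F n) homog_comps_zmod.
HB.instance Definition _ :=
  GRing.isMonoidMorphism.Build S {poly S} (@homog_comps F n) homog_comps_monoid.

Lemma evpC v c : evp v c%:MP = c.
Proof. by rewrite evp.unlock mevalC. Qed.
Lemma evpX v i : evp v 'X_i = v 0 i.
Proof. by rewrite evp.unlock mevalXU. Qed.

Lemma taylorD v p q : taylor v (p + q) = taylor v p + taylor v q.
Proof. exact: rmorphD. Qed.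
Lemma taylorM v p q : taylor v (p * q) = taylor v p * taylor v q.
Proof. exact: rmorphM. Qed.
Lemma evpD v p q : evp v (p + q) = evp v p + evp v q.
Proof. exact: rmorphD. Qed.
Lemma evpB v p q : evp v (p - q) = evp v p - evp v q.
Proof. exact: rmorphB. Qed.
Lemma evpM v p q : evp v (p * q) = evp v p * evp v q.
Proof. exact: rmorphM. Qed.
Lemma homog_compsD p q : homog_comps (p + q) = homog_comps p + homog_comps q.
Proof. exact: rmorphD. Qed.
Lemma homog_compsM p q : homog_comps (p * q) = homog_comps p * homog_comps q.
Proof. exact: rmorphM. Qed.
Lemma taylorC v c : taylor v c%:MP = (c%:MP)%:P.
Proof. by rewrite taylor.unlock mmapC. Qed.
Lemma taylorX v i : taylor v 'X_i = ('X_i)%:P + (v 0 i)%:MP *: 'X.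
Proof. by rewrite taylor.unlock mmapX mmap1U. Qed.
Lemma homog_compsC c : homog_comps (c%:MP : S) = (c%:MP)%:P.
Proof. by rewrite homog_comps.unlock mmapC. Qed.
Lemma homog_compsX i : homog_comps ('X_i : S) = 'X_i *: 'X.
Proof. by rewrite homog_comps.unlock mmapX mmap1U. Qed.

Lemma taylor_coef0 v p : (taylor v p)`_0 = p.
Proof.
rewrite -horner_coef0.
pose f := [the {rmorphism S -> S} of horner_eval 0 \o taylor v].
apply: (mpoly_rmorph_eq (f := f) (g := idfun)) => [c|i]; rewrite /f /= /horner_eval.
  by rewrite taylorC hornerC.
by rewrite taylorX hornerD hornerC hornerZ hornerX mulr0 addr0.
Qed.

Lemma homog_comps_sum p : \sum_(d < size (homog_comps p)) (homog_comps p)`_d = p.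
Proof.
have -> : \sum_(d < size (homog_comps p)) (homog_comps p)`_d = (homog_comps p).[1].
  by rewrite horner_coef; apply: eq_bigr => d _; rewrite expr1n mulr1.
pose f := [the {rmorphism S -> S} of horner_eval 1 \o @homog_comps F n].
apply: (mpoly_rmorph_eq (f := f) (g := idfun)) => [c|i]; rewrite /f /= /horner_eval.
  by rewrite homog_compsC hornerC.
by rewrite homog_compsX hornerZ hornerX mulr1.
Qed.

Lemma homog_comps_coef0 p : (homog_comps p)`_0 = (evp 0 p)%:MP.
Proof.
rewrite -horner_coef0.
pose f := [the {rmorphism S -> S} of horner_eval 0 \o @homog_comps F n].
pose g := [the {rmorphism S -> S} of @mpolyC n F \o evp 0].
apply: (mpoly_rmorph_eq (f := f) (g := g)) => [c|i]; rewrite /f /g /= /horner_eval.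
  by rewrite homog_compsC hornerC evpC.
by rewrite homog_compsX hornerZ hornerX mulr0 evpX mxE mpolyC0.
Qed.

(** Both properties, collected in [good], pass to sums in one degree and to products, where degrees
    add. They are proved for all components of [p] at once, so that induction can run over
    constants, variables, sums and products. *)
Lemma taylor_homog_comps v p d :
  (size (taylor v (homog_comps p)`_d) <= d.+1)%N /\
  (taylor v (homog_comps p)`_d)`_d = (evp v (homog_comps p)`_d)%:MP.
Proof.
pose good d q := (size (taylor v q) <= d.+1)%N /\ (taylor v q)`_d = (evp v q)%:MP.
have good0 e : good e 0 by rewrite /good !rmorph0 size_poly0 coef0.
have goodD e q r : good e q -> good e r -> good e (q + r).
  move=> [sq cq] [sr cr]; split; last by rewrite taylorD evpD coefD cq cr mpolyCD.
  by rewrite taylorD (leq_trans (size_polyD _ _)) // geq_max sq.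
have goodM e1 e2 q r : good e1 q -> good e2 r -> good (e1 + e2)%N (q * r).
  move=> [sq cq] [sr cr]; split.
    rewrite taylorM (leq_trans (size_polyMleq _ _)) //.
    by rewrite -subn1 leq_subLR add1n -addSn -addnS leq_add.
  (* In the coefficient of index [e1 + e2] only the product of the two top coefficients survives:
     any other term exceeds one of the size bounds. *)
  rewrite taylorM evpM coefM (bigD1 (inord e1)) //= inordK ?ltnS ?leq_addr //.
  rewrite addKn cq cr.
  rewrite big1 ?addr0 ?mpolyCM // => j; rewrite -val_eqE /= inordK ?ltnS ?leq_addr //.
  rewrite neq_ltn => /orP[je|ej].
    rewrite [X in _ * X]nth_default ?mulr0 // (leq_trans sr) // ltn_subRL.
    by rewrite ltn_add2r.
  by rewrite nth_default ?mul0r // (leq_trans sq).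
move: d; elim/mpoly_ring_ind: p => [c|i|p q IHp IHq|p q IHp IHq] d.
- rewrite homog_compsC coefC; case: eqP => [->|_]; last exact: good0.
  by rewrite /good taylorC size_polyC_leq1 coefC evpC.
- rewrite homog_compsX coefZ coefX; case: eqP => [->|_]; last first.
    by rewrite mulr0; apply: good0.
  rewrite mulr1 /good taylorX evpX coefD coefC coefZ coefX mulr1 add0r; split=> //.
  rewrite (leq_trans (size_polyD _ _)) // geq_max (leq_trans (size_polyC_leq1 _)) //.
  by rewrite (leq_trans (size_scale_leq _ _)) // size_polyX.
- by rewrite homog_compsD coefD; apply: goodD.
rewrite homog_compsM coefM; apply: (big_ind (good d)) => [|q' r|j _].
- exact: good0.
- exact: goodD.
have {1}-> : d = (j + (d - j))%N by rewrite subnKC // -ltnS.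
exact: goodM.
Qed.

Definition vmonic (v : 'rV[F]_n) (p : S) : Prop :=
  exists2 a : F, a != 0 & lead_coef (taylor v p) = a%:MP.

Lemma vmonicM v p q : vmonic v p -> vmonic v q -> vmonic v (p * q).
Proof.
move=> [a a0 pa] [b b0 qb]; exists (a * b); first by rewrite mulf_neq0.
by rewrite rmorphM lead_coefM pa qb mpolyCM.
Qed.

Lemma homog_comp_lead v p d : evp v (homog_comps p)`_d != 0 ->
  size (taylor v (homog_comps p)`_d) = d.+1 /\ vmonic v (homog_comps p)`_d.
Proof.
move=> pv; have [sp cp] := taylor_homog_comps v p d.
have {}sp : size (taylor v (homog_comps p)`_d) = d.+1.
  apply/eqP; rewrite eqn_leq sp ltnNge; apply/negP => sp'.
  by move: cp; rewrite nth_default // => /esym/eqP; rewrite mpolyC_eq0 (negPf pv).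
by split=> //; exists (evp v (homog_comps p)`_d) => //; rewrite lead_coefE sp cp.
Qed.

Lemma homog_comp_neq0 v p : evp v p != 0 -> exists d, evp v (homog_comps p)`_d != 0.
Proof.
move=> pv; apply: contrapT => np; case/eqP: pv; rewrite -(homog_comps_sum p) rmorph_sum.
by rewrite big1 // => d _; apply/eqP/negPn/negP => dv; apply: np; exists d.
Qed.

(** [taylor v] turns [q(p)] into the composite of [q] with the nonconstant polynomial [taylor v p],
    whose leading coefficient is a power of [a]. *)
Lemma vmonic_horner v p (q : {poly F}) : q \is monic ->
  (1 < size (taylor v p))%N -> vmonic v p ->
  vmonic v (map_poly (@mpolyC n F) q).[p].
Proof.
move=> mq sp [a a0 pa]; exists (a ^+ (size q).-1); first by rewrite expf_neq0.
pose r := map_poly (polyC \o @mpolyC n F) q.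
have -> : taylor v (map_poly (@mpolyC n F) q).[p] =
    (map_poly (@mpolyC n F) q) \Po taylor v p.
  rewrite /comp_poly -horner_map /=; congr (_.[_]).
  by rewrite -!map_poly_comp; apply: eq_map_poly => c /=; rewrite taylorC.
rewrite lead_coef_comp // pa lead_coef_map (monicP mq) rmorph1 mul1r -rmorphXn.
by rewrite size_map_poly.
Qed.

End PolynomialScaling.

(** * The group action *)

Section Action.
Variables (F : fieldType) (gT : finGroupType) (G : {group gT}) (n : nat).
Variable rG : mx_representation F G n.
Local Notation S := {mpoly F[n]}.
Local Notation act := (poly_act rG).

HB.instance Definition _ g := GRing.RMorphism.copy (act g)
  (comp_mpoly [tuple lin_form rG g j | j < n]).

Lemma actC g c : act g c%:MP = c%:MP.
Proof. exact: comp_mpolyC. Qed.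

Lemma actX g i : act g 'X_i = lin_form rG g i.
Proof. by rewrite /poly_act comp_mpolyXU -tnth_nth tnth_mktuple. Qed.

Lemma actKV g : g \in G -> cancel (act g) (act g^-1%g).
Proof. by move=> gG p; rewrite -poly_actM ?groupV // mulVg poly_act1. Qed.

Lemma act_eq0 g p : g \in G -> act g p = 0 -> p = 0.
Proof. by move=> gG /(congr1 (act g^-1%g)); rewrite actKV // rmorph0. Qed.

Lemma evp_act v g p : evp v (act g p) = evp (v *m rG g) p.
Proof.
rewrite !evp.unlock /poly_act comp_mpoly_meval; apply: meval_eq => i.
rewrite tnth_mktuple /lin_form rmorph_sum mxE; apply: eq_bigr => j _.
by rewrite /= mevalZ mevalXU mulrC.
Qed.

(** Since [g] fixes [v], translation by multiples of [v] commutes with the action of [g]. *)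
Lemma taylor_act v g p : v *m rG g = v ->
  taylor v (act g p) = map_poly (act g) (taylor v p).
Proof.
move=> vg; pose f := [the {rmorphism S -> {poly S}} of taylor v \o act g].
pose h := [the {rmorphism S -> {poly S}} of map_poly (act g) \o taylor v].
apply: (mpoly_rmorph_eq (f := f) (g := h)) => [c|i]; rewrite /f /h /=.
  by rewrite actC taylorC map_polyC /= actC.
rewrite taylorX rmorphD /= map_polyC map_polyZ map_polyX /= actC actX.
rewrite /lin_form rmorph_sum /=.
under eq_bigr => j _ do rewrite -mul_mpolyC rmorphM /= taylorC taylorX mulrDr.
rewrite big_split /=; congr (_ + _).
  by rewrite rmorph_sum; apply: eq_bigr => j _; rewrite -mul_mpolyC rmorphM.
rewrite -{2}vg mxE rmorph_sum scaler_suml; apply: eq_bigr => j _.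
by rewrite mul_polyC scalerA -mpolyCM mulrC.
Qed.

Lemma homog_comps_act g p : homog_comps (act g p) = map_poly (act g) (homog_comps p).
Proof.
pose f := [the {rmorphism S -> {poly S}} of @homog_comps F n \o act g].
pose h := [the {rmorphism S -> {poly S}} of map_poly (act g) \o @homog_comps F n].
apply: (mpoly_rmorph_eq (f := f) (g := h)) => [c|i]; rewrite /f /h /=.
  by rewrite actC homog_compsC map_polyC /= actC.
rewrite homog_compsX map_polyZ map_polyX /= actX /lin_form rmorph_sum scaler_suml.
apply: eq_bigr => j _; rewrite -mul_mpolyC rmorphM /= homog_compsC homog_compsX.
by rewrite mul_polyC scalerA.
Qed.

Definition fixed_by (D : {set gT}) : {pred S} :=
  [pred p | [forall g in D, act g p == p]].

Lemma fixed_byP (D : {set gT}) p :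
  reflect (forall g, g \in D -> act g p = p) (p \in fixed_by D).
Proof. by apply: (iffP forall_inP) => h g gD; apply/eqP; apply: h. Qed.

Fact fixed_by_closed D : subring_closed (fixed_by D).
Proof.
split=> [|p q /fixed_byP hp /fixed_byP hq|p q /fixed_byP hp /fixed_byP hq];
  apply/fixed_byP=> g gD.
- exact: rmorph1.
- by rewrite (rmorphB (act g)) /= hp ?hq.
- by rewrite (rmorphM (act g)) /= hp ?hq.
Qed.
HB.instance Definition _ D :=
  GRing.isSubringClosed.Build S (fixed_by D) (fixed_by_closed D).

Lemma fixed_byC D c : c%:MP \in fixed_by D.
Proof. by apply/fixed_byP => g _; apply: actC. Qed.

Lemma homog_comps_fixed D p d : p \in fixed_by D -> (homog_comps p)`_d \in fixed_by D.
Proof.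
move=> /fixed_byP pD; apply/fixed_byP => g gD.
by rewrite -[act g _]coef_map -homog_comps_act pD.
Qed.

Lemma taylor_fixed (D : {set gT}) v p : (forall g, g \in D -> v *m rG g = v) ->
  p \in fixed_by D -> taylor v p \is a polyOver (fixed_by D).
Proof.
move=> vD /fixed_byP pD; apply/polyOverP => i; apply/fixed_byP => g gD.
by rewrite -[act g _]coef_map -taylor_act ?vD // pD.
Qed.

(** Left multiplication by [k] permutes [D'], which will be a group or the complement of a
    stabilizer. *)
Lemma fixed_prod (D : {group gT}) (D' : {set gT}) (T : comNzRingType)
    (f : {rmorphism T -> T}) (E : gT -> T) k :
  k \in D -> (forall g, (k * g \in D')%g = (g \in D')) ->
  (forall g, g \in D' -> f (E g) = E (k * g)%g) ->
  f (\prod_(g in D') E g) = \prod_(g in D') E g.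
Proof.
move=> kD kD' fE; rewrite rmorph_prod [RHS](reindex_inj (mulgI k)) /=.
by apply: eq_big => [g|g gD']; rewrite ?kD' // fE.
Qed.

Definition norm (D : {set gT}) (s : S) : S := \prod_(g in D) act g s.

Lemma norm_fixed (D : {group gT}) s : D \subset G -> norm D s \in fixed_by D.
Proof.
move=> sDG; apply/fixed_byP => k kD; apply: (fixed_prod kD) => g.
  by rewrite groupMl.
by move=> gD; rewrite poly_actM // (subsetP sDG).
Qed.

Lemma evp_norm (D : {group gT}) v s :
  evp v (norm D s) = \prod_(g in D) evp (v *m rG g) s.
Proof. by rewrite rmorph_prod; apply: eq_bigr => g _; rewrite /= evp_act. Qed.

(* The x_j - v_j vanish at v but not simultaneously at 0, hence so does the
   norm of one of them. *)
Lemma homog_invariant_exists v : v != 0 -> exists h,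
  [/\ h \in fixed_by G, vmonic v h & (1 < size (taylor v h))%N].
Proof.
move=> /rV0Pn[j vj]; pose N := norm G ('X_j - (v 0 j)%:MP).
have Nv : evp v N = 0.
  rewrite evp_norm (bigD1 1%g) //= repr_mx1 mulmx1.
  by rewrite evpB evpX evpC subrr mul0r.
have N0 : evp 0 N != 0.
  rewrite evp_norm prodf_seq_neq0; apply/allP => g _; apply/implyP => _.
  by rewrite mul0mx evpB evpX evpC mxE sub0r oppr_eq0.
(* Subtracting the value at [0] removes the component of degree zero and keeps the value at [v]
   nonzero, so a component of positive degree is nonzero at [v]. *)
pose r := N - (evp 0 N)%:MP.
have rG' : r \in fixed_by G by rewrite rpredB ?fixed_byC // norm_fixed.
have rv : evp v r != 0 by rewrite evpB Nv evpC sub0r oppr_eq0.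
have [[|d] rd] := homog_comp_neq0 rv.
  move: rd; rewrite homog_comps_coef0 evpC evpB evpC subrr.
  by rewrite eqxx.
have [sr mr] := homog_comp_lead rd; exists (homog_comps r)`_d.+1.
by split=> //; [apply: homog_comps_fixed | rewrite sr].
Qed.

End Action.

(** * Separation of the cosets of a stabilizer, and the transfer *)

Section Stabilizer.
Variables (F : fieldType) (gT : finGroupType) (G : {group gT}) (n : nat).
Variable rG : mx_representation F G n.
Variable v : 'rV[F]_n.
Local Notation S := {mpoly F[n]}.
Local Notation act := (poly_act rG).
Local Notation H := (rstab_group rG v).

Lemma stab_sub : H \subset G.
Proof. by apply/subsetP => g; rewrite inE => /andP[]. Qed.

Lemma stab_fix g : g \in H -> v *m rG g = v.
Proof. by rewrite inE => /andP[_ /eqP]. Qed.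

(* h is the norm over H of a product of affine linear forms which vanish at the
   v rG g, for g outside H, but not at v. *)
Lemma separating_invariant : exists2 h, h \in fixed_by rG H &
  forall g, g \in G :\: H -> evp v h != evp (v *m rG g) h.
Proof.
have lP g : exists l : S, g \in G :\: H -> evp v l != 0 /\ evp (v *m rG g) l = 0.
  have [/setDP[gG]|] := boolP (g \in G :\: H); last by exists 0.
  rewrite inE gG /= => vg; have [j vj] : exists j, v 0 j != (v *m rG g) 0 j.
    apply: contrapT => np; case/eqP: vg; apply/rowP => j.
    by apply/esym/eqP/negPn/negP => vj; apply: np; exists j.
  exists ('X_j - ((v *m rG g) 0 j)%:MP) => _.
  by rewrite evpB evpB !evpX !evpC subr_eq0 subrr.
have [l hl] := choice lP.
pose s := \prod_(g in G :\: H) l g.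
exists (norm rG H s); first exact: norm_fixed stab_sub.
move=> g gGH; have [gG gH] := setDP gGH.
have -> : evp (v *m rG g) (norm rG H s) = 0.
  rewrite evp_norm (bigD1 1%g) //= repr_mx1 mulmx1 rmorph_prod (bigD1 g) //=.
  by have [_ ->] := hl g gGH; rewrite !mul0r.
rewrite evp_norm prodf_seq_neq0; apply/allP => k _; apply/implyP => kH.
rewrite stab_fix // rmorph_prod prodf_seq_neq0.
by apply/allP => g' _; apply/implyP => /hl[].
Qed.

(* The coefficients a_i of Q = prod_(g in G :\: H) (X - g h) satisfy
   sum_i a_i (g h)^i = Q(g h) for all g. *)
Lemma separating_sum : exists (m : nat) (a b : 'I_m -> S) (c : S),
  [/\ forall i, a i \in fixed_by rG H, forall i, b i \in fixed_by rG H, evp v c != 0 &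
      forall g, g \in G -> \sum_i a i * act g (b i) = if g \in H then c else 0].
Proof.
have [h hH hv] := separating_invariant.
pose Q := \prod_(g in G :\: H) ('X - (act g h)%:P).
exists (size Q), (fun i => Q`_i), (fun i => h ^+ i), Q.[h].
have QE g : \sum_(i < size Q) Q`_i * act g (h ^+ i) = Q.[act g h].
  by rewrite horner_coef; apply: eq_bigr => i _; rewrite rmorphXn.
split=> [i|i||g gG].
- apply/fixed_byP => k kH; have kG := subsetP stab_sub k kH.
  pose f := [the {rmorphism {poly S} -> {poly S}} of map_poly (act k)].
  have fQ : f Q = Q.
    apply: (fixed_prod kH) => g; first by rewrite !in_setD !groupMl.
    move=> /setDP[gG _]; rewrite rmorphB /= map_polyX map_polyC /= poly_actM //.
  by have := congr1 (fun q : {poly S} => q`_i) fQ; rewrite coef_map.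
- exact: rpredX.
- rewrite /Q horner_prod rmorph_prod prodf_seq_neq0.
  apply/allP => g _; apply/implyP => gGH.
  by rewrite hornerXsubC /= evpB evp_act subr_eq0 hv.
rewrite QE; have [gH|gH] := boolP (g \in H); first by rewrite (fixed_byP _ _ _ hH).
have gGH : g \in G :\: H by rewrite in_setD gH.
rewrite /Q (bigD1 g) //=; move: (\prod_(_ in _ | _) _) => r.
by rewrite hornerM hornerXsubC subrr mul0r.
Qed.

(** The action preserves degrees, so the identity of [separating_sum] can be read in a degree [d]
    where the component of [c] is nonzero at [v]. Each product then splits into pairs of components
    of degrees [e] and [d - e]. *)
Lemma separating_vmonic : exists (I : finType) (a b : I -> S) (c : S),
  [/\ forall i, a i \in fixed_by rG H, forall i, b i \in fixed_by rG H, vmonic v c &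
      forall g, g \in G -> \sum_i a i * act g (b i) = if g \in H then c else 0].
Proof.
have [m [a [b [c [aH bH cv abc]]]]] := separating_sum.
have [d cd] := homog_comp_neq0 cv; have [_ mc] := homog_comp_lead cd.
exists ('I_m * 'I_d.+1)%type,
  (fun i : 'I_m * 'I_d.+1 => (homog_comps (a i.1))`_(val i.2)),
  (fun i : 'I_m * 'I_d.+1 => (homog_comps (b i.1))`_(d - val i.2)), (homog_comps c)`_d.
split=> // [i|i|g gG]; try exact: homog_comps_fixed.
transitivity ((homog_comps (\sum_i a i * act g (b i)))`_d).
  rewrite rmorph_sum coef_sum.
  rewrite -(pair_bigA _ (fun (i : 'I_m) (e : 'I_d.+1) => (homog_comps (a i))`_(val e) *
    act g (homog_comps (b i))`_(d - val e))) /=.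
  apply: eq_bigr => i _; rewrite homog_compsM coefM.
  by apply: eq_bigr => e _; rewrite homog_comps_act coef_map.
by rewrite abc //; case: ifP => // _; rewrite rmorph0 coef0.
Qed.

Lemma act_repr_coset g p : p \in fixed_by rG H -> g \in G ->
  act (fingroup.repr (g *: H)%g) p = act g p.
Proof.
move=> /fixed_byP pH gG; have /lcosetP[k kH ->] := mem_repr g (lcoset_refl H g).
have kG : k \in G by apply: (subsetP stab_sub).
by rewrite poly_actM ?(pH k).
Qed.

(** Left multiplication by [k] permutes the left cosets, and [act_repr_coset] makes their
    representatives immaterial. *)
Lemma transfer_fixed p : p \in fixed_by rG H ->
  \sum_(C in lcosets H G) act (fingroup.repr C) p \in fixed_by rG G.
Proof.
move=> pH; apply/fixed_byP => k kG; rewrite rmorph_sum /=.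
have lK (A : {set gT}) (x : gT) : (x^-1 *: (x *: A))%g = A.
  by rewrite -lcosetM mulVg lcoset1.
rewrite [RHS](reindex_onto (fun C => k *: C)%g (fun C => k^-1 *: C)%g) /=; last first.
  by move=> C _; rewrite -{1}(invgK k) lK.
apply: eq_big => [C|C]; last first.
  move=> /lcosetsP[g gG ->]; rewrite -lcosetM !act_repr_coset ?groupM //.
  by rewrite poly_actM.
rewrite lK eqxx andbT; apply/lcosetsP/lcosetsP => -[g gG CE].
  by exists (k * g)%g; rewrite ?groupM // CE -lcosetM.
by exists (k^-1 * g)%g; rewrite ?groupM ?groupV // lcosetM -CE lK.
Qed.

End Stabilizer.

(* In characteristic p, take a vector fixed by a Sylow p-subgroup. *)
Lemma fixed_vector_exists (F : fieldType) (gT : finGroupType) (G : {group gT}) n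
    (rG : mx_representation F G n) : (0 < n)%N ->
  exists v : 'rV[F]_n, v != 0 /\ (#|G : rstab_group rG v|%g)%:R != 0 :> F.
Proof.
move=> n0; have [[p pF]|np] := pselect (exists p, p \in [pchar F]); last first.
  exists (const_mx 1); split.
    by apply/rV0Pn; exists (Ordinal n0); rewrite mxE oner_eq0.
  by apply: contra_notN np => i0; apply: natf0_pchar i0; apply: indexg_gt0.
have [P sylP] := Sylow_exists p G; have sPG := pHall_sub sylP.
have := rfix_pgroup_pchar pF rG n0 (pHall_pgroup sylP) sPG.
move=> /rowV0Pn[v /rfix_mxP vP v0]; exists v; split=> //.
have sPH : P \subset rstab_group rG v.
  by apply/subsetP => g gP; rewrite inE (subsetP sPG) //=; apply/eqP/vP.
have sHG : rstab_group rG v \subset G by apply/subsetP => g; rewrite inE => /andP[].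
(* The stabilizer contains [P], so its index divides that of [P], which is prime to [p]. *)
have [_ _] := and3P sylP; rewrite -(dvdn_pcharf pF) p'natE ?(pcharf_prime pF) //.
by apply: contra => /dvdn_trans; apply; apply: indexgS.
Qed.

(** * The invariant ring *)

Section InvariantRing.
Variables (F : fieldType) (gT : finGroupType) (G : {group gT}) (n : nat).
Variable rG : mx_representation F G n.
Local Notation S := {mpoly F[n]}.
Local Notation R := (invring rG).
Local Notation act := (poly_act rG).

Definition invring_const (c : F) : R := InvRing (fixed_byC rG G c).

Fact invring_const_zmod : zmod_morphism invring_const.
Proof. by move=> a b; apply: val_inj; rewrite rmorphB /= mpolyCB. Qed.
Fact invring_const_monoid : monoid_morphism invring_const.
Proof. by split=> [|a b]; apply: val_inj; rewrite ?rmorphM ?rmorph1 //= mpolyCM. Qed.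
HB.instance Definition _ :=
  GRing.isZmodMorphism.Build F R invring_const invring_const_zmod.
HB.instance Definition _ :=
  GRing.isMonoidMorphism.Build F R invring_const invring_const_monoid.

Lemma invring_act (r : R) g : g \in G -> act g (val r) = val r.
Proof. by move: (valP r) => /fixed_byP; apply. Qed.

Definition orbit_poly (j : 'I_n) : {poly S} := \prod_(g in G) ('X - (act g 'X_j)%:P).

Lemma orbit_poly_fixed j i : (orbit_poly j)`_i \in fixed_by rG G.
Proof.
apply/fixed_byP => k kG.
pose f := [the {rmorphism {poly S} -> {poly S}} of map_poly (act k)].
have fQ : f (orbit_poly j) = orbit_poly j.
  apply: (fixed_prod kG) => g; first by rewrite groupMl.
  by move=> gG; rewrite rmorphB /= map_polyX map_polyC /= poly_actM.
by have := congr1 (fun q : {poly S} => q`_i) fQ; rewrite coef_map.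
Qed.

Definition orbit_coefs : seq R :=
  [seq InvRing (orbit_poly_fixed ji.1 ji.2) | ji <-
     [seq (j, i) | j <- enum 'I_n, i <- iota 0 (size (orbit_poly j))]].

(** Each variable is a root of its monic orbit polynomial, so [S] is integral over the image of [B].
    The equation of an invariant [r] has coefficients in [R], hence holds in [R]. *)
Lemma invring_integral (B : comNzRingType) (phi : {rmorphism B -> R}) :
  (forall a, exists b, phi b = invring_const a) ->
  (forall y, y \in orbit_coefs -> exists b, phi b = y) ->
  forall r, integralOver phi r.
Proof.
move=> phiF phiY r.
pose psi := [the {rmorphism B -> S} of val \o phi].
have intS p : integralOver psi p.
  elim/mpoly_ring_ind: p => [c|j|p q|p q].
  - have [b bc] := phiF c; have -> : c%:MP = psi b by rewrite /= bc.
    exact: integral_id.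
  - apply: (@integral_root_monic _ _ _ _ (orbit_poly j)).
    + by apply: monic_prod => g _; apply: monicXsubC.
    + rewrite /root /orbit_poly (bigD1 1%g) //=; move: (\prod_(_ in _ | _) _) => q.
      by rewrite hornerM hornerXsubC poly_act1 subrr mul0r.
    apply/integral_poly => i; have [le_i|lt_i] := leqP (size (orbit_poly j)) i.
      by rewrite nth_default //; apply: integral0.
    have [|b bi] := phiY (InvRing (orbit_poly_fixed j i)).
      apply/mapP; exists (j, i) => //; apply/allpairsPdep.
      by exists j, i; rewrite mem_enum mem_iota.
    have -> : (orbit_poly j)`_i = psi b by rewrite /= bi.
    exact: integral_id.
  - exact: integral_add.
  - exact: integral_mul.
have [q mq qr] := intS (val r); exists q => //.
move: qr; rewrite /root map_poly_comp horner_map /= => /eqP qr.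
by apply/eqP/val_inj; exact: qr.
Qed.

Lemma invring_tofrac_inj : injective (@FracField.tofrac S \o val : R -> _).
Proof. by move=> a b /eqP /=; rewrite tofrac_eq => /eqP/val_inj. Qed.

End InvariantRing.

(** * The transfer on fractions and on Cech cochains *)

Section Transfer.
Variables (F : fieldType) (gT : finGroupType) (G : {group gT}) (n : nat).
Variable rG : mx_representation F G n.
Variable v : 'rV[F]_n.
Local Notation S := {mpoly F[n]}.
Local Notation R := (invring rG).
Local Notation H := (rstab_group rG v).
Local Notation K := {fraction S}.
Local Notation tofr := (@FracField.tofrac S).
Local Notation inc := (tofr \o (val : R -> S)).

(** [R] and the ring of [H]-invariants are both viewed inside the fraction field of [S], so that
    their Cech cochains are families in the same field. *)
Definition inG (k : K) : Prop := exists r : R, k = inc r.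
Definition inH (k : K) : Prop := exists s, s \in fixed_by rG H /\ k = tofr s.

Definition frac_act (g : gT) : K -> K := frac_lift (tofr \o poly_act rG g).

Fact frac_act_inj g : g \in G -> forall s, (tofr \o poly_act rG g) s = 0 -> s = 0.
Proof. by move=> gG s /= /eqP; rewrite tofrac_eq0 => /eqP/(act_eq0 gG). Qed.

(** The denominator is invariant under [G], so [g] acts on the numerator only. *)
Lemma frac_actE g k (s : S) (y : R) M : g \in G -> val y != 0 ->
  k * tofr (val y) ^+ M = tofr s ->
  frac_act g k * tofr (val y) ^+ M = tofr (poly_act rG g s).
Proof.
move=> gG y0; rewrite -tofracXn => ks.
have yM0 : val y ^+ M != 0 by rewrite expf_neq0.
rewrite -[RHS](frac_liftE (frac_act_inj gG) yM0 ks) /=.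
by rewrite (rmorphXn (poly_act rG g)) /= invring_act // tofracXn.
Qed.

Lemma frac_act_stab g k (s : S) (y : R) M : g \in H -> s \in fixed_by rG H ->
  val y != 0 -> k * tofr (val y) ^+ M = tofr s -> frac_act g k = k.
Proof.
move=> gH /fixed_byP sH y0 ks; have gG : g \in G by apply: (subsetP (stab_sub rG v)).
have yM0 : tofr (val y) ^+ M != 0 by rewrite expf_neq0 // tofrac_eq0.
by apply: (mulIf yM0); rewrite (frac_actE gG y0 ks) sH.
Qed.

Definition transfer (k : K) : K :=
  \sum_(C in lcosets H G) frac_act (fingroup.repr C) k.

Lemma repr_lcosets C : C \in lcosets H G -> fingroup.repr C \in G.
Proof.
move=> /lcosetsP[g gG ->]; have /lcosetP[k kH ->] := mem_repr g (lcoset_refl H g).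
by rewrite groupM // (subsetP (stab_sub rG v)).
Qed.

Lemma transferD : {morph transfer : k l / k + l}.
Proof.
move=> k l; rewrite /transfer -big_split; apply: eq_bigr => C /repr_lcosets gG.
exact: (frac_liftD (frac_act_inj gG)).
Qed.

Section Cech.
Variables (m : nat) (f : 'I_m -> R).
Local Notation x := (fun j => inc (f j)).

Lemma fprod_inc J : fprod x J = tofr (val (\prod_(j in J) f j)).
Proof. by rewrite -[RHS]/(inc _) rmorph_prod. Qed.

Lemma fprod_inc_neq0 J : fprod x J != 0 -> val (\prod_(j in J) f j) != 0.
Proof. by rewrite fprod_inc tofrac_eq0. Qed.

Lemma transfer_loc : preserves_loc x inH inG transfer.
Proof.
move=> J J0 k; have y0 := fprod_inc_neq0 J0; rewrite fprod_inc.
move=> [M [s [sH ks]]]; have tG := transfer_fixed sH.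
exists M, (InvRing tG : R); rewrite /= rmorph_sum mulr_suml.
apply: eq_bigr => C /repr_lcosets gG.
exact: frac_actE ks.
Qed.

(** After exchanging the sums, the coset represented by [g] carries the coefficient
    [\sum_i a i * g (b i)], which is [c] for the coset [H] and zero for all others. *)
Lemma transfer_separating (I : finType) (a b : I -> S) (c : S) J k :
  (forall g, g \in G ->
     \sum_i a i * poly_act rG g (b i) = if g \in H then c else 0) ->
  fprod x J != 0 -> locin inH (fprod x J) k ->
  tofr c * k = \sum_i tofr (a i) * transfer (tofr (b i) * k).
Proof.
move=> abc J0; have := fprod_inc_neq0 J0; rewrite fprod_inc.
move: (\prod_(j in J) f j) => y y0 [M [s [sH ks]]].
transitivity (\sum_(C in lcosets H G)
    tofr (\sum_i a i * poly_act rG (fingroup.repr C) (b i)) *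
    frac_act (fingroup.repr C) k).
  rewrite (bigD1 (H : {set gT})) /=; last first.
    by apply/lcosetsP; exists 1%g; rewrite ?lcoset1.
  have rH : fingroup.repr H \in H by apply: mem_repr (group1 H).
  have rHG : fingroup.repr H \in G by apply: (subsetP (stab_sub rG v)).
  rewrite abc // rH (frac_act_stab rH sH y0 ks) big1 ?addr0 // => C /andP[CH nCH].
  rewrite abc ?repr_lcosets //; case: ifP => [rC|]; last by rewrite tofrac0 mul0r.
  case/eqP: nCH; case/lcosetsP: CH rC => g gG -> rC.
  have : fingroup.repr (g *: H)%g \in (g *: H)%g := mem_repr _ (lcoset_refl H g).
  by move=> /lcoset_eqP <-; rewrite lcoset_id.
rewrite /transfer; under [RHS]eq_bigr => i _ do rewrite mulr_sumr.
rewrite exchange_big /=; apply: eq_bigr => C /repr_lcosets gG.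
rewrite rmorph_sum mulr_suml; apply: eq_bigr => i _.
rewrite /frac_act (frac_liftM (frac_act_inj gG)).
rewrite (frac_lift_tofrac (frac_act_inj gG)) /=.
by rewrite tofracM; apply: esym (mulrA _ _ _).
Qed.

Lemma transfer_inG J k : fprod x J != 0 -> locin inG (fprod x J) k ->
  transfer k = k *+ #|G : H|%g.
Proof.
move=> J0; have := fprod_inc_neq0 J0; rewrite fprod_inc.
move: (\prod_(j in J) f j) => y y0 [M [r kr]].
rewrite -card_lcosets -sumr_const; apply: eq_bigr => C /repr_lcosets gG.
have yM0 : tofr (val y) ^+ M != 0 by apply: expf_neq0; rewrite tofrac_eq0.
apply: (mulIf yM0); rewrite (frac_actE gG y0 kr) kr /=.
by rewrite invring_act.
Qed.

Lemma inG_inH k : inG k -> inH k.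
Proof.
move=> [r ->]; exists (val r); split=> //; apply/fixed_byP => g gH.
have gG : g \in G by apply: (subsetP (stab_sub rG v)).
exact: invring_act.
Qed.

Lemma inH_tofrac s : s \in fixed_by rG H -> inH (tofr s).
Proof. by exists s. Qed.

Lemma inHD k l : inH k -> inH l -> inH (k + l).
Proof. by move=> [s [sH ->]] [t [tH ->]]; exists (s + t); rewrite rpredD ?rmorphD. Qed.

Lemma inHM k l : inH k -> inH l -> inH (k * l).
Proof. by move=> [s [sH ->]] [t [tH ->]]; exists (s * t); rewrite rpredM ?rmorphM. Qed.

Lemma inH_hasse N b : (b < N.+1)%N ->
  preserves_loc x inH inH (hasse (taylor v) N b).
Proof.
move=> bN J J0 k; have y0 := fprod_inc_neq0 J0; rewrite fprod_inc.
apply: (hasse_locin (taylor_coef0 v) bN) => // [s sH|].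
  by apply: taylor_fixed sH => g; apply: stab_fix.
have [s [sH /eqP]] := inG_inH (ex_intro _ (\prod_(j in J) f j) erefl).
by rewrite tofrac_eq => /eqP->.
Qed.

End Cech.
End Transfer.

(** * Vanishing of Cech cohomology of finite length *)

Theorem finite_length_cohomology_eq0 (F : fieldType) (gT : finGroupType)
    (G : {group gT}) n (rG : mx_representation F G n) (m : nat)
    (f : 'I_m -> invring rG) (i : nat) : (0 < n)%N ->
  finite_length (cech_cohomology f (invring rG)^o i) ->
  forall h : cech_cohomology f (invring rG)^o i, h = 0.
Proof.
move=> n0 fl; have [v [v0 iv]] := fixed_vector_exists rG n0.
have [h0 [h0G mh0 sh0]] := homog_invariant_exists rG v0.
have [I [a [b [c [aH bH mc abc]]]]] := separating_vmonic rG v.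
pose R := invring rG; pose S := {mpoly F[n]}.
pose inc := [the {rmorphism R -> {fraction S}} of @FracField.tofrac S \o val].
have inc_inj : injective inc := @invring_tofrac_inj _ _ _ _ rG.
pose x := fun j => inc (f j); pose AH := @inH _ _ _ _ rG v.
pose AG := @inG _ _ _ _ rG.
have AH0 : AH 0 by exists 0; rewrite rpred0 rmorph0.
have AHN1 : AH (- 1) by exists (- 1); rewrite rpredN1 rmorphN1.
have AHD := @inHD _ _ _ _ rG v; have AHM := @inHM _ _ _ _ rG v.
have AGH : forall k, AG k -> AH k by move=> k; apply: inG_inH.
have AHprod J : AH (fprod x J) by apply: AGH; eexists; apply: fprod_inc.
have [q mq hq] := finite_length_annihilator (iota := [the {rmorphism F -> R} of
  @invring_const _ _ _ _ rG]) (InvRing h0G) (@invring_integral _ _ _ _ rG) fl.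
pose r0 : R := (map_poly (@invring_const _ _ _ _ rG) q).[InvRing h0G].
have r0E : val r0 = (map_poly (@mpolyC n F) q).[h0].
  rewrite /r0 -horner_map; congr (_.[_]).
  by apply/polyP => j; rewrite !coef_map.
have killG : annihilates x AG i (inc r0).
  by split; [exists r0 | apply: (cohomology_annihilator inc_inj)].
(* The transfer carries the annihilator from [R] to the [H]-invariants at the cost of the factor
   [c]. *)
have killH : annihilates x AH i (inc r0 * FracField.tofrac c).
  apply: (annihilates_transfer (tr := transfer rG v)
    (a := fun l => FracField.tofrac (a l)) (b := fun l => FracField.tofrac (b l))
    AH0 AHN1 AHD AHM AHprod AGH _ _ _ _ _ _ killG).
  - exact: transferD.
  - exact: transfer_loc.
  - by move=> l; apply: inH_tofrac.
  - by move=> l; apply: inH_tofrac.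
  - apply: inH_tofrac; move: (abc 1%g (group1 G)); rewrite group1 => <-.
    by apply: rpred_sum => l _; rewrite poly_act1 rpredM.
  - by move=> J k J0; apply: (transfer_separating abc J0).
pose w := val r0 * c.
have [al al0 wal] : vmonic v w.
  by apply: vmonicM => //; rewrite r0E; apply: vmonic_horner.
(* [N] is the degree of [w(x + t v)] in [t], so the Hasse derivative of order [N] sends [w] to the
   constant [al]. Computing modulo ['X^(N.+1)] makes this order available. *)
pose N := (size (taylor v w)).-1.
have t0 := taylor_coef0 v; pose D := hasse (taylor v) N.
have DA d u : (d < N.+1)%N -> AH u -> AH (D d u).
  move=> dN [s [sH ->]]; rewrite /D (hasse_tofrac t0) //; apply: inH_tofrac.
  by apply: (polyOverP (taylor_fixed _ sH)) => g; apply: stab_fix.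
have killw : annihilates x AH i (FracField.tofrac w) by rewrite /w tofracM.
have := annihilates_hasse AH0 AHN1 AHD AHM AHprod (fun d dN => hasseD t0 dN)
  (fun d dN => inH_hasse (v := v) (f := f) dN) DA (hasse0 N t0)
  (fun d u u' dN => hasseM t0 u u' dN) killw (ltnSn N).
rewrite (hasse_tofrac t0) // -[_`_N]/(lead_coef _) wal => [[_ kill]].
apply: (cohomology_vanish inc_inj) => z zG.
(* A cocycle over [R] is one over the [H]-invariants, where multiplication by [al] makes it a
   coboundary. *)
have zH : fcocycle x AH i z.
  by apply: (fcocycle_map (Phi := id) _ _ zG) => // J J0 k [M kM]; exists M; apply: AGH.
pose idx : F := (#|G : rstab_group rG v|%g)%:R.
pose t (e : F) : {fraction S} := FracField.tofrac e%:MP_[n].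
have tE e : t e = inc (invring_const rG e) by [].
have tAH : AH (t (al * idx)^-1) by apply: AGH; exists (invring_const rG (al * idx)^-1).
(* The coboundary [al * z] is divided by [al * idx] and transferred back to [R]. The transfer
   multiplies fractions over [R] by the index, so the result is [z]. *)
apply: eq_fcoboundary (fcoboundary_map (transferD rG v) (@transfer_loc _ _ _ _ _ v _ f)
  (fcoboundary_mul AHM tAH (kill z zH))) => J J0.
have -> : t (al * idx)^-1 * (FracField.tofrac al%:MP_[n] * z J) = t idx^-1 * z J.
  by rewrite mulrA -tofracM -mpolyCM invfM mulrAC mulVf // mul1r.
have [zA _ _] := zG; have [M [r zr]] := zA J J0.
rewrite (@transfer_inG _ _ _ _ rG v _ f J) //; last first.
  by exists M, (invring_const rG idx^-1 * r); rewrite -mulrA zr rmorphM.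
rewrite -mulrnAl -mulr_natr -[_%:R in LHS](rmorph_nat inc).
by rewrite -[_%:R in LHS](rmorph_nat (invring_const rG)) tE -rmorphM
  -rmorphM mulVf // rmorph1 rmorph1 mul1r.
Qed.

Theorem corollary3p9 (F : fieldType) (gT : finGroupType) (G : {group gT})
    (rG : mx_representation F G 4) (a : {pred invring rG})
    (a_ideal : @GRing.submod_closed (invring rG) (invring rG)^o a)
    (a_homog : homogeneous a)
    (m : nat) (f : 'I_m -> invring rG) (a_gen : generates f a)
    (i : nat)
    (Hi_fl : finite_length (cech_cohomology f (invring rG)^o i)) :
  forall h : cech_cohomology f (invring rG)^o i, h = 0.
Proof. exact: finite_length_cohomology_eq0. Qed.
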